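(* For type expressions $A_1,\dots,A_n,B$ the following are equivalent: (a) $\{A_1,\dots,A_n\}\vdash B$ is derivable in $\mathbf{LA}\mu$; (b) $\{x_1:A_1,\dots,x_n:A_n\}\vdash M:B$ is derivable in $\lambda$A for some distinct individual variables $x_1,\dots,x_n$ and some $\lambda$-term $M$; (c) for every $\mathbf{LA}$-frame $(\mathcal W,\rhd,R)$, every hereditary valuation $\xi$ and every $p\in\mathcal W$, if $\models^\xi_p A_i$ for all $i$ then $\models^\xi_p B$.
   Context: Type expressions: fix a countably infinite set of type variables $X,Y,Z,\dots$. Pseudo type expressions are generated by $A::=X\mid A\to A\mid \bullet A\mid \mu X.A$ ($\mu$ binds $X$; $\alpha$-convertible expressions are identified; $\to$ associates to the right; $\bullet$ binds tighter than $\to$, which binds tighter than $\mu$). $A[B/X]$ denotes capture-avoiding substitution. $\top$ abbreviates $\mu X.\bullet X$, and $\bullet^n A$ denotes $A$ prefixed by $n$ copies of $\bullet$. The tail $t(A)$ is defined by $t(X)=X$, $t(A\to B)=t(B)$, $t(\bullet A)=\bullet t(A)$, $t(\mu X.A)=\mu X.t(A)$; it always has the form $\bullet^{m_0}\mu X_1.\bullet^{m_1}\mu X_2.\cdots\mu X_n.\bullet^{m_n}Y$. $A$ is a $\top$-variant iff $Y=X_i$ for some $1\le i\le n$ with $X_i\notin\{X_{i+1},\dots,X_n\}$ and $m_i+\dots+m_n\ge 1$. $A$ is proper in $X$ iff: a variable $Y$ is proper in $X$ iff $Y\neq X$; $\bullet A$ is always proper in $X$; $A\to B$ is proper in $X$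 iff both $A,B$ are proper in $X$ or $B$ is a $\top$-variant; for $Y\ne X$, $\mu Y.A$ is proper in $X$ iff $A$ is proper in $X$ or $\mu Y.A$ is a $\top$-variant. Type expressions are the least set of pseudo type expressions containing all type variables, closed under $\to$ and $\bullet$, and containing $\mu X.A$ whenever it contains $A$ and $A$ is proper in $X$. Equality: $\cong$ is the least relation on type expressions such that: $A\cong A$; $A\cong B$ implies $B\cong A$; $A\cong B$ and $B\cong C$ imply $A\cong C$; $A\cong B$ implies $\bullet A\cong\bullet B$; $A\cong C$ and $B\cong D$ imply $A\to B\cong C\to D$; $A\to\top\cong\top$; $\mu X.A\cong A[\mu X.A/X]$; and if $A\cong C[A/X]$ with $C$ proper in $X$, then $A\cong\mu X.C$. $\simeq$ is the least relation satisfying the same closure conditions and additionally $\bullet(A\to B)\simeq\bullet A\to\bullet B$. Subtyping: a subtyping assumption $\gamma$ is a finite set of pairs $X\preceq Y$ of type variables in which each type variable occurs at most once; $FTV(\gamma)$ is the set of variables occurring in it. Judgments $\gamma\vdash A\preceq B$ are derived by the rules: $\gamma\cup\{X\preceq Y\}\vdash X\preceq Y$; $\gamma\vdash A\preceq\top$; from $A\simeq B$ infer $\gamma\vdash A\preceq B$; from $\gamma_1\vdash A\preceq B$ and $\gamma_2\vdash B\preceq C$ infer $\gamma_1\cup\gamma_2\vdash A\preceq C$; from $\gamma\vdash A\preceq B$ infer $\gamma\vdash\bullet A\preceq\bullet B$; from $\gamma_1\vdash A'\preceq A$ and $\gamma_2\vdash B\preceq B'$ infer $\gamma_1\cup\gamma_2\vdash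 A\to B\preceq A'\to B'$; from $\gamma\cup\{X\preceq Y\}\vdash A\preceq B$ infer $\gamma\vdash\mu X.A\preceq\mu Y.B$, provided $X\notin FTV(\gamma)\cup FTV(B)$, $Y\notin FTV(\gamma)\cup FTV(A)$, $A$ is proper in $X$ and $B$ is proper in $Y$; and $\gamma\vdash A\preceq\bullet A$. All sets $\gamma\cup\{X\preceq Y\}$, $\gamma_1\cup\gamma_2$ must be well-formed subtyping assumptions. $A\preceq B$ means $\{\}\vdash A\preceq B$ is derivable. Typing system $\lambda$A: untyped $\lambda$-terms $M::=x\mid\lambda x.M\mid MM$ (identified up to $\alpha$-conversion). A typing context $\Gamma$ is a finite map from individual variables to type expressions, written $\{x_1:A_1,\dots,x_n:A_n\}$; $\bullet\Gamma$ is $\{x_1:\bullet A_1,\dots,x_n:\bullet A_n\}$; unions of contexts must be well-formed (a variable receives at most one type). Rules: (var) $\Gamma\cup\{x:A\}\vdash x:A$; (shift) from $\bullet\Gamma\vdash M:\bullet A$ infer $\Gamma\vdash M:A$; ($\top$) $\Gamma\vdash M:\top$; ($\preceq$) from $\Gamma\vdash M:A$ and $A\preceq B$ infer $\Gamma\vdash M:B$; ($\to$I) from $\Gamma\cup\{x:A\}\vdash M:B$ infer $\Gamma\vdash\lambda x.M:A\to B$; ($\to$E) from $\Gamma_1\vdash M:A\to B$ and $\Gamma_2\vdash N:A$ infer $\Gamma_1\cup\Gamma_2\vdash MN:B$. The formal system $\mathbf{LA}\mu$ derives judgments $\Gamma\vdash A$ ($\Gamma$ a finite set of formulae, i.e.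 type expressions; $\bullet\Gamma=\{\bullet B\mid B\in\Gamma\}$) by the rules: (assump) $\Gamma\cup\{A\}\vdash A$; (nec) from $\Gamma_1\vdash A$ infer $\bullet\Gamma_1\cup\Gamma_2\vdash\bullet A$; (4) from $\Gamma\vdash\bullet A$ infer $\Gamma\vdash\bullet\bullet A$; ($\to$I) from $\Gamma\cup\{A\}\vdash B$ infer $\Gamma\vdash A\to B$; ($\to$E) from $\Gamma_1\vdash A\to B$ and $\Gamma_2\vdash A$ infer $\Gamma_1\cup\Gamma_2\vdash B$; (fold) from $\Gamma\vdash A[\mu X.A/X]$ infer $\Gamma\vdash\mu X.A$; (unfold) from $\Gamma\vdash\mu X.A$ infer $\Gamma\vdash A[\mu X.A/X]$; (L) from $\Gamma\vdash\bullet A\to\bullet B$ infer $\Gamma\vdash\bullet(A\to B)$; (approx) from $\Gamma\vdash A$ infer $\Gamma\vdash\bullet A$. Kripke semantics: an $\mathbf{LA}$-frame is a triple $(\mathcal W,\rhd,R)$ with $\mathcal W$ nonempty, $\rhd$ a binary relation with no infinite chain $p_0\rhd p_1\rhd\cdots$, $R$ reflexive and transitive, such that: $pRq\rhd r$ implies $p\rhd r$; $p\rhd q$ implies $pRq$; and whenever $p\rhd q\,R\,q'$ there is $r$ with $pRr\rhd q'$ such that $r\rhd s$ implies $q'Rs$ for every $s$. A valuation $\xi$ assigns to each type variable a map $\mathcal W\to\{\mathbf t,\mathbf f\}$; it is hereditary if $pRq$ and $\xi(X)(p)=\mathbf t$ imply $\xi(X)(q)=\mathbf t$. Forcing $\models^\xi_p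 A$ is defined by well-founded induction: $\models^\xi_p A$ if $A$ is a $\top$-variant; otherwise $\models^\xi_p X$ iff $\xi(X)(p)=\mathbf t$; $\models^\xi_p\bullet A$ iff $\models^\xi_q A$ for all $q$ with $p\rhd q$; $\models^\xi_p A\to B$ iff for all $q$ with $pRq$, $\models^\xi_q A$ implies $\models^\xi_q B$; $\models^\xi_p\mu X.A$ iff $\models^\xi_p A[\mu X.A/X]$. *)

(* Defs.v *)
(* Locally nameless representation of type expressions and
   lambda-terms (so alpha-convertible expressions are literally identified). *)
From Stdlib Require Import Arith List Classical ClassicalEpsilon.
Import ListNotations.

(* Pseudo type expressions: free type variables are named by nat,
   mu-bound variables are de Bruijn indices.                               *)
Inductive ty : Type :=
| TFVar  : nat -> ty
| TBVar  : nat -> ty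
| TArr   : ty -> ty -> ty
| TLater : ty -> ty
| TMu    : ty -> ty.

Fixpoint open_rec (k : nat) (u : ty) (t : ty) : ty :=
  match t with
  | TFVar x => TFVar x
  | TBVar i => if Nat.eqb i k then u else TBVar i
  | TArr a b => TArr (open_rec k u a) (open_rec k u b)
  | TLater a => TLater (open_rec k u a)
  | TMu a => TMu (open_rec (S k) u a)
  end.

(* open A u  =  A[u/X]  where mu X. A  is represented by  TMu A *)
Definition open (t u : ty) : ty := open_rec 0 u t.

Fixpoint fv (t : ty) : list nat :=
  match t with
  | TFVar x => [x]
  | TBVar _ => []
  | TArr a b => fv a ++ fv b
  | TLater a => fv a
  | TMu a => fv a
  end.

Definition top : ty := TMu (TLater (TBVar 0)).

Fixpoint tail (t : ty) : ty :=
  match t with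
  | TFVar x => TFVar x
  | TBVar i => TBVar i
  | TArr _ b => tail b
  | TLater a => TLater (tail a)
  | TMu a => TMu (tail a)
  end.

(* Walk along a tail  bullet^{m0} mu X1. bullet^{m1} ... mu Xn. bullet^{mn} Y.
   env lists, for each enclosing mu (innermost first), the number of
   bullets seen after that mu.  A tail ending with the variable bound by
   mu X_i (de Bruijn: the innermost binder of that name) is a top-variant
   iff m_i + ... + m_n >= 1. *)
Fixpoint tv_rec (t : ty) (env : list nat) : bool :=
  match t with
  | TFVar _ => false
  | TBVar k => match nth_error env k with Some m => Nat.leb 1 m | None => false end
  | TArr _ b => tv_rec b env   (* never reached on tails *)
  | TLater a => tv_rec a (map S env)
  | TMu a => tv_rec a (0 :: env)
  end.

Definition top_variant (A : ty) : bool := tv_rec (tail A) [].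

Fixpoint proper (X : nat) (A : ty) : Prop :=
  match A with
  | TFVar Y => Y <> X
  | TBVar _ => True          (* bound variables are distinct from X *)
  | TLater _ => True
  | TArr A1 A2 => (proper X A1 /\ proper X A2) \/ top_variant A2 = true
  | TMu A1 => proper X A1 \/ top_variant (TMu A1) = true
  end.

(* Type expressions: least set containing variables, closed under -> and
   bullet, containing mu X.A whenever it contains A and A is proper in X.
   (mu X. A with A named is TMu B where A = open B (TFVar X), X fresh.) *)
Inductive wf : ty -> Prop :=
| wf_var X : wf (TFVar X)
| wf_arr A B : wf A -> wf B -> wf (TArr A B)
| wf_later A : wf A -> wf (TLater A)
| wf_mu A X : ~ In X (fv A) -> wf (open A (TFVar X)) ->
    proper X (open A (TFVar X)) -> wf (TMu A).

Inductive teq (L : bool) : ty -> ty -> Prop :=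
| teq_refl A : wf A -> teq L A A
| teq_sym A B : teq L A B -> teq L B A
| teq_trans A B C : teq L A B -> teq L B C -> teq L A C
| teq_later A B : teq L A B -> teq L (TLater A) (TLater B)
| teq_arr A B C D : teq L A C -> teq L B D -> teq L (TArr A B) (TArr C D)
| teq_arrtop A : wf A -> teq L (TArr A top) top
| teq_unfold A : wf (TMu A) -> teq L (TMu A) (open A (TMu A))
| teq_fix A C : teq L A (open C A) -> wf (TMu C) (* i.e. C proper in X *) ->
    teq L A (TMu C)
| teq_distr A B : L = true -> wf A -> wf B ->
    teq L (TLater (TArr A B)) (TArr (TLater A) (TLater B)).

Definition cong := teq false.
Definition simeq := teq true.

(* Subtyping assumptions: finite sets of pairs X ≼ Y (as lists, with set
   semantics) in which each type variable occurs at most once.            *)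
Definition assump := list (nat * nat).

Definition assump_ok (g : assump) : Prop :=
  forall p q, In p g -> In q g ->
    (fst p = fst q -> p = q) /\ (snd p = snd q -> p = q) /\ fst p <> snd q.

Definition same_set {T : Type} (l1 l2 : list T) : Prop :=
  forall x, In x l1 <-> In x l2.

Definition in_ftv (X : nat) (g : assump) : Prop :=
  exists Y, In (X, Y) g \/ In (Y, X) g.

Inductive sub : assump -> ty -> ty -> Prop :=
| sub_assump g X Y : assump_ok g -> In (X, Y) g -> sub g (TFVar X) (TFVar Y)
| sub_top g A : assump_ok g -> wf A -> sub g A top
| sub_eq g A B : assump_ok g -> simeq A B -> sub g A B
| sub_trans g g1 g2 A B C : sub g1 A B -> sub g2 B C ->
    assump_ok g -> same_set g (g1 ++ g2) -> sub g A C
| sub_later g A B : sub g A B -> sub g (TLater A) (TLater B)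
| sub_arr g g1 g2 A A' B B' : sub g1 A' A -> sub g2 B B' ->
    assump_ok g -> same_set g (g1 ++ g2) -> sub g (TArr A B) (TArr A' B')
| sub_mu g g' A B X Y :
    (* naming of the binders: mu X.(open A X) = TMu A, mu Y.(open B Y) = TMu B *)
    ~ In X (fv (TMu A)) -> ~ In Y (fv (TMu B)) ->
    sub g' (open A (TFVar X)) (open B (TFVar Y)) ->
    assump_ok g' -> same_set g' ((X, Y) :: g) ->
    ~ in_ftv X g -> ~ In X (fv (open B (TFVar Y))) ->
    ~ in_ftv Y g -> ~ In Y (fv (open A (TFVar X))) ->
    proper X (open A (TFVar X)) -> proper Y (open B (TFVar Y)) ->
    sub g (TMu A) (TMu B)
| sub_approx g A : assump_ok g -> wf A -> sub g A (TLater A).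

Definition subtype (A B : ty) : Prop := sub [] A B.

Inductive tm : Type :=
| tvar : nat -> tm
| tbvar : nat -> tm
| tlam : tm -> tm
| tapp : tm -> tm -> tm.

Fixpoint open_tm_rec (k : nat) (u : tm) (t : tm) : tm :=
  match t with
  | tvar x => tvar x
  | tbvar i => if Nat.eqb i k then u else tbvar i
  | tlam a => tlam (open_tm_rec (S k) u a)
  | tapp a b => tapp (open_tm_rec k u a) (open_tm_rec k u b)
  end.

Definition open_tm (t u : tm) : tm := open_tm_rec 0 u t.

Fixpoint fv_tm (t : tm) : list nat :=
  match t with
  | tvar x => [x]
  | tbvar _ => []
  | tlam a => fv_tm a
  | tapp a b => fv_tm a ++ fv_tm b
  end.

Inductive lc_tm : tm -> Prop :=
| lc_var x : lc_tm (tvar x)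
| lc_lam t : (forall x, lc_tm (open_tm t (tvar x))) -> lc_tm (tlam t)
| lc_app a b : lc_tm a -> lc_tm b -> lc_tm (tapp a b).

Definition ctx := nat -> option ty.

Definition ctx_ok (G : ctx) : Prop :=
  (exists l, forall x, G x <> None -> In x l) /\
  (forall x A, G x = Some A -> wf A).

Definition ctx_compat (G1 G2 : ctx) : Prop :=
  forall x A B, G1 x = Some A -> G2 x = Some B -> A = B.

Definition ctx_union (G1 G2 : ctx) : ctx :=
  fun x => match G1 x with Some A => Some A | None => G2 x end.

Definition ctx_single (x : nat) (A : ty) : ctx :=
  fun y => if Nat.eqb y x then Some A else None.

Definition ctx_later (G : ctx) : ctx := fun x => option_map TLater (G x).

Inductive typing : ctx -> tm -> ty -> Prop :=
| T_var G x A : ctx_ok G -> G x = Some A -> typing G (tvar x) A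
| T_shift G G' M A : typing G' M (TLater A) ->
    (forall x, G' x = ctx_later G x) -> typing G M A
| T_top G M : ctx_ok G -> lc_tm M -> typing G M top
| T_sub G M A B : typing G M A -> subtype A B -> typing G M B
| T_abs G G' M x A B :
    ~ In x (fv_tm M) ->   (* naming of the binder: lambda x.(open M x) *)
    typing G' (open_tm M (tvar x)) B ->
    ctx_compat G (ctx_single x A) ->
    (forall y, G' y = ctx_union G (ctx_single x A) y) ->
    typing G (tlam M) (TArr A B)
| T_app G G1 G2 M N A B : typing G1 M (TArr A B) -> typing G2 N A ->
    ctx_compat G1 G2 -> (forall y, G y = ctx_union G1 G2 y) ->
    typing G (tapp M N) B.

Fixpoint ctx_of (xs : list nat) (As : list ty) : ctx :=
  match xs, As with
  | x :: xs', A :: As' => fun y => if Nat.eqb y x then Some A else ctx_of xs' As' y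
  | _, _ => fun _ => None
  end.

(* The formal system LA-mu; contexts are finite sets of formulae (lists
   with set semantics). *)
Inductive LAmu : list ty -> ty -> Prop :=
| LA_assump G A : (forall C, In C G -> wf C) -> In A G -> LAmu G A
| LA_nec G G1 G2 A : LAmu G1 A -> (forall C, In C G2 -> wf C) ->
    same_set G (map TLater G1 ++ G2) -> LAmu G (TLater A)
| LA_4 G A : LAmu G (TLater A) -> LAmu G (TLater (TLater A))
| LA_impI G G' A B : LAmu G' B -> same_set G' (A :: G) -> LAmu G (TArr A B)
| LA_impE G G1 G2 A B : LAmu G1 (TArr A B) -> LAmu G2 A ->
    same_set G (G1 ++ G2) -> LAmu G B
| LA_fold G A : wf (TMu A) -> LAmu G (open A (TMu A)) -> LAmu G (TMu A)
| LA_unfold G A : LAmu G (TMu A) -> LAmu G (open A (TMu A))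
| LA_L G A B : LAmu G (TArr (TLater A) (TLater B)) -> LAmu G (TLater (TArr A B))
| LA_approx G A : LAmu G A -> LAmu G (TLater A).

Record LAframe : Type := {
  W : Type;
  W_inh : inhabited W;
  succ : W -> W -> Prop;
  Rel : W -> W -> Prop;
  succ_nochain : ~ exists f : nat -> W, forall n, succ (f n) (f (S n));
  Rel_refl : forall p, Rel p p;
  Rel_trans : forall p q r, Rel p q -> Rel q r -> Rel p r;
  fr_ax1 : forall p q r, Rel p q -> succ q r -> succ p r;
  fr_ax2 : forall p q, succ p q -> Rel p q;
  fr_ax3 : forall p q q', succ p q -> Rel q q' ->
      exists r, Rel p r /\ succ r q' /\ (forall s, succ r s -> Rel q' s)
}.

Definition valuation (F : LAframe) := nat -> W F -> bool.

Definition hereditary (F : LAframe) (xi : valuation F) : Prop :=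
  forall X p q, Rel F p q -> xi X p = true -> xi X q = true.

Fixpoint rk (A : ty) : nat :=
  if top_variant A then 0 else
  match A with
  | TArr A1 A2 => S (Nat.max (rk A1) (rk A2))
  | TMu A1 => S (rk A1)
  | _ => 0
  end.

Definition fw_lt (F : LAframe) (x y : W F * ty) : Prop :=
  succ F (fst y) (fst x) \/ (Rel F (fst y) (fst x) /\ rk (snd x) < rk (snd y)).

Lemma succ_wf (F : LAframe) : well_founded (fun q p => succ F p q).
Proof.
  assert (step : forall x, ~ Acc (fun q p => succ F p q) x ->
            exists y, succ F x y /\ ~ Acc (fun q p => succ F p q) y).
  { intros x Hx. apply NNPP. intro Hn. apply Hx. constructor. intros y Hy.
    apply NNPP. intro Hy'. apply Hn. exists y. split; assumption. }
  intro p. apply NNPP. intro Hp.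
  pose (S0 := {x : W F | ~ Acc (fun q p => succ F p q) x}).
  assert (g : forall s : S0, {t : S0 | succ F (proj1_sig s) (proj1_sig t)}).
  { intros [x Hx]. destruct (constructive_indefinite_description _ (step x Hx))
      as [y [Hy1 Hy2]]. exists (exist _ y Hy2). exact Hy1. }
  pose (f := fix f (n : nat) : S0 :=
               match n with 0 => exist _ p Hp | S m => proj1_sig (g (f m)) end).
  apply (succ_nochain F). exists (fun n => proj1_sig (f n)).
  intro n. simpl. exact (proj2_sig (g (f n))).
Qed.

Lemma fw_lt_wf (F : LAframe) : well_founded (fw_lt F).
Proof.
  assert (H : forall p, Acc (fun q p => succ F p q) p ->
            forall n q A, Rel F p q -> rk A <= n -> Acc (fw_lt F) (q, A)).
  { intros p Hacc. induction Hacc as [p _ IHp].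
    intro n. induction n as [|n IHn]; intros q A Hpq Hrk;
      constructor; intros [r B] [Hs | [Hr Hlt]]; simpl in *.
    - apply (IHp r (fr_ax1 F _ _ _ Hpq Hs) (rk B) r B (Rel_refl F r) (le_n _)).
    - exfalso. inversion Hrk. rewrite H0 in Hlt. inversion Hlt.
    - apply (IHp r (fr_ax1 F _ _ _ Hpq Hs) (rk B) r B (Rel_refl F r) (le_n _)).
    - apply IHn. + exact (Rel_trans F _ _ _ Hpq Hr). + apply le_S_n.
      exact (Nat.lt_le_trans _ _ _ Hlt Hrk). }
  intros [p A]. apply (H p (succ_wf F p) (rk A) p A (Rel_refl F p) (le_n _)).
Qed.

(* One step of the forcing definition.  Recursive calls at (q, A') with
   p R q are guarded by rk A' < rk A; for type expressions these guards
   always hold (in the -> case trivially, in the mu case by properness),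
   so the clauses are exactly the ones of the paper. *)
Definition force_body (F : LAframe) (xi : valuation F) (x : W F * ty)
  (rec : forall y, fw_lt F y x -> Prop) : Prop :=
  (match x as x0 return (forall y, fw_lt F y x0 -> Prop) -> Prop with
   | (p, A) => fun rec =>
     let call (q : W F) (A' : ty) (h : Rel F p q) : Prop :=
       match lt_dec (rk A') (rk A) with
       | left hl => rec (q, A') (or_intror (conj h hl))
       | right _ => False
       end in
     if top_variant A then True else
     match A with
     | TFVar X => xi X p = true
     | TBVar _ => False
     | TLater A' => forall q (h : succ F p q), rec (q, A') (or_introl h)
     | TArr A1 A2 => forall q (h : Rel F p q), call q A1 h -> call q A2 h
     | TMu A1 => call p (open A1 (TMu A1)) (Rel_refl F p)
     end
   end) rec.

Definition forces (F : LAframe) (xi : valuation F) (p : W F) (A : ty) : Prop :=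
  Fix (fw_lt_wf F) (fun _ => Prop) (force_body F xi) (p, A).

(* Main.v *)
(* (a) implies (b) by recursion on derivations; necessitation is admissible in the
   typing system because bullets distribute over arrows.

   (b) implies (c) by soundness.  Two rules are not locally sound.  For (shift) the
   frame is extended below each world by a copy of it.  For the rule on recursive
   types one argues by induction along the frame: properness makes the forcing of
   [A] depend on [X] at strictly later worlds only.

   (c) implies (a) by a canonical model.  A world is a theory [p] with a number [n]
   bounding how often one can refute a boxed formula [TLater A] of a finite set [L]
   of instances of subexpressions, each time passing to the theory generated by
   [C : TLater C in p] and, thanks to Loeb's rule, [TLater A].  The number decreases
   along the accessibility relation, which makes it conversely well founded. *)
From Stdlib Require Import Arith List Lia Classical ClassicalEpsilon.
From Stdlib Require Import FunctionalExtensionality.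
Require Import Defs.
Import ListNotations.

(** * Well-formedness on de Bruijn indices *)

(** Structural induction on a type expression never reaches the unfolding of [TMu A]. Most semantic
    arguments therefore recurse along [fw_lt]: either pass to a strictly later world, or stay above
    the present one and lower [rk]. Unfolding lowers [rk] except at top-variants, which are split
    off first. They are forced everywhere by definition, so completeness owes a derivation of each
    of them; it is extracted from the tail, with one use of Loeb's rule per binder. In the canonical
    model, inclusion of the bodies of boxed formulas is not conversely well founded by itself: the
    theory of all type expressions would succeed itself. Hence the number in each world. Only the
    finite set [L] is measured and only its members get a truth lemma, but theories range over all
    type expressions, because the third frame condition puts a bullet in front of every formula of
    some world, and these need not lie in [L]. *)

(* [proper] for the bound variable with index [k]. *)
Fixpoint bproper (k : nat) (A : ty) : Prop :=
  match A with
  | TFVar _ => True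
  | TBVar i => i <> k
  | TLater _ => True
  | TArr A1 A2 => (bproper k A1 /\ bproper k A2) \/ top_variant A2 = true
  | TMu A1 => bproper (S k) A1 \/ top_variant (TMu A1) = true
  end.

Fixpoint wfb (n : nat) (A : ty) : Prop :=
  match A with
  | TFVar _ => True
  | TBVar i => i < n
  | TLater A1 => wfb n A1
  | TArr A1 A2 => wfb n A1 /\ wfb n A2
  | TMu A1 => wfb (S n) A1 /\ bproper 0 A1
  end.

Lemma tv_rec_tail A env : tv_rec (tail A) env = tv_rec A env.
Proof. revert env; induction A; intros; simpl; auto. Qed.

Lemma top_variantE A : top_variant A = tv_rec A [].
Proof. apply tv_rec_tail. Qed.

Lemma top_variant_arr A B : top_variant (TArr A B) = top_variant B.
Proof. reflexivity. Qed.

Lemma top_variant_later A : top_variant (TLater A) = top_variant A.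
Proof. rewrite !top_variantE; reflexivity. Qed.

Lemma tv_rec_app A env env' :
  tv_rec A env = true -> tv_rec A (env ++ env') = true.
Proof.
  revert env env'; induction A; intros env env' H; simpl in *; auto.
  - destruct (nth_error env n) eqn:E; [|discriminate].
    rewrite nth_error_app1, E; auto. apply nth_error_Some; congruence.
  - rewrite map_app; auto.
  - apply (IHA (0 :: env)); auto.
Qed.

Lemma tv_rec_open u A env m : tv_rec u [] = true ->
  tv_rec A (env ++ [m]) = true -> tv_rec (open_rec (length env) u A) env = true.
Proof.
  intro Hu; revert env m; induction A; intros env m H; simpl in *; auto.
  - destruct (Nat.eqb_spec n (length env)).
    + apply (tv_rec_app u [] env Hu).
    + simpl. destruct (Nat.lt_ge_cases n (length env)).
      * rewrite nth_error_app1 in H; auto.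
      * rewrite nth_error_app2 in H by auto.
        destruct (n - length env) as [|[|]] eqn:E; simpl in H; try lia; discriminate.
  - eauto.
  - rewrite map_app in H; simpl in H. apply IHA in H. now rewrite length_map in H.
  - apply (IHA (0 :: env) m H).
Qed.

Lemma top_variant_unfold A :
  top_variant (TMu A) = true -> top_variant (open A (TMu A)) = true.
Proof.
  rewrite !top_variantE; intro H. apply (tv_rec_open (TMu A) A [] 0); auto.
Qed.

Lemma tv_rec_open_mono k u A env : length env <= k ->
  tv_rec A env = true -> tv_rec (open_rec k u A) env = true.
Proof.
  revert k env; induction A; intros k env Hk H; simpl in *; auto.
  - destruct (nth_error env n) eqn:E; [|discriminate].
    assert (n < length env) by (apply nth_error_Some; congruence).
    destruct (Nat.eqb_spec n k); [lia|]. simpl; rewrite E; auto.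
  - apply IHA; auto. rewrite length_map; auto.
  - apply IHA; auto; simpl; lia.
Qed.

Lemma top_variant_open k u A :
  top_variant A = true -> top_variant (open_rec k u A) = true.
Proof. rewrite !top_variantE; apply tv_rec_open_mono; simpl; lia. Qed.

Lemma tv_rec_open_fvar k X A env : length env <= k ->
  tv_rec (open_rec k (TFVar X) A) env = tv_rec A env.
Proof.
  revert k env; induction A; intros k env Hk; simpl in *; auto.
  - destruct (Nat.eqb_spec n k); simpl; auto. subst.
    destruct (nth_error env k) eqn:E; auto.
    assert (k < length env) by (apply nth_error_Some; congruence). lia.
  - apply IHA; auto. rewrite length_map; auto.
  - apply IHA; auto; simpl; lia.
Qed.

Lemma top_variant_open_fvar k X A :
  top_variant (open_rec k (TFVar X) A) = top_variant A.
Proof. rewrite !top_variantE; apply tv_rec_open_fvar; simpl; lia. Qed.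

Lemma bproper_open_fvar j k X A : j <> k ->
  (bproper j (open_rec k (TFVar X) A) <-> bproper j A).
Proof.
  revert j k; induction A; intros j k Hjk; simpl; try tauto.
  - destruct (Nat.eqb_spec n k); simpl; subst; intuition.
  - rewrite IHA1, IHA2, top_variant_open_fvar by auto. tauto.
  - rewrite IHA by lia. change (TMu (open_rec (S k) (TFVar X) A))
      with (open_rec k (TFVar X) (TMu A)). rewrite top_variant_open_fvar. tauto.
Qed.

Lemma proper_open_fvar k X A : ~ In X (fv A) ->
  (proper X (open_rec k (TFVar X) A) <-> bproper k A).
Proof.
  revert k; induction A; intros k HX; simpl in *; try tauto.
  - destruct (Nat.eqb_spec n k); simpl; subst; intuition.
  - rewrite in_app_iff in HX.
    rewrite IHA1, IHA2, top_variant_open_fvar by tauto. tauto.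
  - rewrite IHA by auto. change (TMu (open_rec (S k) (TFVar X) A))
      with (open_rec k (TFVar X) (TMu A)). rewrite top_variant_open_fvar. tauto.
Qed.

Lemma wfb_open_fvar k X A : wfb k (open_rec k (TFVar X) A) <-> wfb (S k) A.
Proof.
  revert k; induction A; intros k; simpl; try tauto.
  - destruct (Nat.eqb_spec n k); simpl; lia.
  - rewrite IHA1, IHA2; tauto.
  - apply IHA.
  - rewrite IHA, bproper_open_fvar by lia. tauto.
Qed.

Lemma exists_fresh (l : list nat) : exists x, ~ In x l.
Proof.
  exists (S (list_max l)). intro H.
  assert (H' : Forall (fun k => k <= list_max l) l) by (apply list_max_le; auto).
  rewrite Forall_forall in H'. apply H' in H. lia.
Qed.

Fixpoint size (A : ty) : nat :=
  match A with
  | TArr A B => S (size A + size B)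
  | TLater A | TMu A => S (size A)
  | _ => 0
  end.

Lemma size_open_fvar k X A : size (open_rec k (TFVar X) A) = size A.
Proof.
  revert k; induction A; intro k; simpl; auto.
  destruct (Nat.eqb n k); auto.
Qed.

(** Trades the fresh name under each binder for a bound on indices, which makes well-formedness a
    recursive predicate. The converse goes by [size], since a body opened with a name is not a
    subterm. *)
Lemma wf_wfb A : wf A <-> wfb 0 A.
Proof.
  split.
  - induction 1; simpl; auto. split.
    + apply (wfb_open_fvar 0 X); auto.
    + apply (proper_open_fvar 0 X); auto.
  - remember (size A) as n eqn:E. assert (Hn : size A <= n) by lia. clear E.
    revert A Hn; induction n; intros A Hn H; destruct A; simpl in *; try lia.
    all: try solve [constructor; try apply IHn; tauto || lia].
    destruct (exists_fresh (fv A)) as [X HX]. apply (wf_mu A X); auto.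
    + apply IHn; [unfold open; rewrite size_open_fvar; lia|].
      apply (wfb_open_fvar 0 X); tauto.
    + apply (proper_open_fvar 0 X); tauto.
Qed.

Lemma bproper_closed n k A : wfb n A -> n <= k -> bproper k A.
Proof.
  revert n k; induction A; intros m k H Hk; simpl in *; auto; try lia.
  - left; split; [apply (IHA1 m)|apply (IHA2 m)]; tauto.
  - left; apply (IHA (S m)); [tauto|lia].
Qed.

Lemma open_rec_closed n k u A : wfb n A -> n <= k -> open_rec k u A = A.
Proof.
  revert n k; induction A; intros m k H Hk; simpl in *; auto.
  - destruct (Nat.eqb_spec n k); auto; lia.
  - f_equal; [apply (IHA1 m)|apply (IHA2 m)]; tauto.
  - f_equal; apply (IHA m); auto.
  - f_equal; apply (IHA (S m)); [tauto|lia].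
Qed.

Lemma wfb_mono m n A : wfb m A -> m <= n -> wfb n A.
Proof.
  revert m n; induction A; intros m p H Hk; simpl in *; auto; try lia.
  - split; [apply (IHA1 m)|apply (IHA2 m)]; tauto.
  - eauto.
  - split; [apply (IHA (S m)); [tauto|lia] | tauto].
Qed.

(** * Simultaneous substitution *)

(* Free variables are replaced by [f], and the index [k + i] by [g i]. *)
Fixpoint msub (f g : nat -> ty) (k : nat) (A : ty) : ty :=
  match A with
  | TFVar x => f x
  | TBVar i => if i <? k then TBVar i else g (i - k)
  | TArr A1 A2 => TArr (msub f g k A1) (msub f g k A2)
  | TLater A1 => TLater (msub f g k A1)
  | TMu A1 => TMu (msub f g (S k) A1)
  end.

Definition scons (u : ty) (g : nat -> ty) (i : nat) : ty :=
  match i with 0 => u | S j => g j end.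

Section MSub.
Variables f g : nat -> ty.
Hypothesis Hf : forall x, wfb 0 (f x).
Hypothesis Hg : forall i, wfb 0 (g i).

Lemma tv_rec_msub k A env : length env <= k ->
  tv_rec A env = true -> tv_rec (msub f g k A) env = true.
Proof.
  revert k env; induction A; intros k env Hk H; simpl in *; auto.
  - discriminate.
  - destruct (nth_error env n) eqn:E; [|discriminate].
    assert (n < length env) by (apply nth_error_Some; congruence).
    destruct (Nat.ltb_spec n k); [|lia]. simpl; rewrite E; auto.
  - apply IHA; auto. rewrite length_map; auto.
  - apply IHA; auto; simpl; lia.
Qed.

Lemma top_variant_msub k A :
  top_variant A = true -> top_variant (msub f g k A) = true.
Proof. rewrite !top_variantE; apply tv_rec_msub; simpl; lia. Qed.

Lemma bproper_msub j k A : j < k -> bproper j A -> bproper j (msub f g k A).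
Proof.
  revert j k; induction A; intros j k Hj H; simpl in *; auto.
  - apply (bproper_closed 0); auto; lia.
  - destruct (Nat.ltb_spec n k); simpl; auto. apply (bproper_closed 0); auto; lia.
  - destruct H as [[H1 H2]|H]; [left; auto|right; apply top_variant_msub; auto].
  - destruct H as [H|H].
    + left; apply IHA; auto; lia.
    + right; apply (top_variant_msub k) in H; exact H.
Qed.

Lemma wfb_msub m k A : wfb m A -> wfb k (msub f g k A).
Proof.
  revert m k; induction A; intros m k H; simpl in *; auto.
  - apply (wfb_mono 0); auto; lia.
  - destruct (Nat.ltb_spec n k); simpl; auto. apply (wfb_mono 0); auto; lia.
  - split; [apply (IHA1 m)|apply (IHA2 m)]; tauto.
  - eauto.
  - split; [apply (IHA (S m)); tauto|]. apply bproper_msub; [lia|tauto].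
Qed.

(** Opening a binder amounts to extending the environment. No shifting of indices occurs because all
    substituted types are closed. *)
Lemma open_msub k u A :
  open_rec k u (msub f g (S k) A) = msub f (scons u g) k A.
Proof.
  revert k; induction A; intro k; simpl; try congruence.
  - apply (open_rec_closed 0); auto; lia.
  - destruct (Nat.ltb_spec n (S k)).
    + simpl. destruct (Nat.eqb_spec n k), (Nat.ltb_spec n k); try lia; auto.
      replace (n - k) with 0 by lia; auto.
    + destruct (Nat.ltb_spec n k); try lia.
      replace (n - k) with (S (n - S k)) by lia; simpl.
      apply (open_rec_closed 0); auto; lia.
Qed.

Lemma msub_closed j k k' A : wfb j A -> j <= k -> j <= k' ->
  msub f g k A = msub f g k' A.
Proof.
  revert j k k'; induction A; intros j k k' H Hk Hk'; simpl in *; auto.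
  - destruct (Nat.ltb_spec n k), (Nat.ltb_spec n k'); auto; lia.
  - f_equal; [apply (IHA1 j)|apply (IHA2 j)]; tauto.
  - f_equal; eauto.
  - f_equal; apply (IHA (S j)); try lia; tauto.
Qed.

Lemma msub_open k u A : wfb 0 u -> wfb (S k) A ->
  msub f g k (open_rec k u A) = open_rec k (msub f g 0 u) (msub f g (S k) A).
Proof.
  intro Hu; revert k; induction A; intros k H; simpl in *; try congruence.
  - symmetry; apply (open_rec_closed 0); auto; lia.
  - destruct (Nat.eqb_spec n k); destruct (Nat.ltb_spec n (S k)); try lia; simpl.
    + subst; rewrite Nat.eqb_refl. apply (msub_closed 0); auto; lia.
    + destruct (Nat.ltb_spec n k); try lia.
      destruct (Nat.eqb_spec n k); try lia; auto.
  - rewrite IHA1, IHA2; tauto.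
  - rewrite IHA; tauto.
  - rewrite IHA; tauto.
Qed.

Lemma msub_id k A : wfb k A -> (forall x, In x (fv A) -> f x = TFVar x) ->
  msub f g k A = A.
Proof.
  revert k; induction A; intros k H Hx; simpl in *; auto.
  - destruct (Nat.ltb_spec n k); auto; lia.
  - rewrite IHA1, IHA2; try tauto; intros; apply Hx, in_app_iff; auto.
  - rewrite IHA; auto.
  - rewrite IHA; tauto.
Qed.

End MSub.

Lemma open_msub_id u A : wfb 1 A ->
  open A u = msub TFVar (scons u TFVar) 0 A.
Proof.
  intro H. unfold open. rewrite <- open_msub; try (simpl; auto; fail).
  f_equal. symmetry; apply msub_id; auto.
Qed.

Lemma wf_open u A : wf u -> wfb 1 A -> wf (open A u).
Proof.
  rewrite !wf_wfb; intros Hu H. rewrite open_msub_id by auto.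
  apply (wfb_msub _ _) with (m := 1); simpl; auto. intros [|]; simpl; auto.
Qed.

Lemma wf_unfold A : wf (TMu A) -> wf (open A (TMu A)).
Proof.
  intro H. apply wf_open; auto. apply wf_wfb in H; simpl in H; tauto.
Qed.

Lemma wf_arr_inv A B : wf (TArr A B) -> wf A /\ wf B.
Proof. rewrite !wf_wfb; auto. Qed.

Lemma wf_later_inv A : wf (TLater A) -> wf A.
Proof. rewrite !wf_wfb; auto. Qed.

Lemma wf_top : wf top.
Proof. apply wf_wfb; simpl; auto. Qed.

Lemma proper_open X k u A : proper X u -> proper X A ->
  proper X (open_rec k u A).
Proof.
  intro Hu; revert k; induction A; intros k H; simpl in *; auto.
  - destruct (Nat.eqb n k); simpl; auto.
  - destruct H as [[H1 H2]|H]; auto using top_variant_open.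
  - destruct H as [H|H]; auto. right. apply (top_variant_open k u) in H; exact H.
Qed.

Lemma proper_unfold X A : proper X (TMu A) -> proper X (open A (TMu A)).
Proof.
  intro H. simpl in H. destruct H as [H|H].
  - apply proper_open; simpl; auto.
  - assert (T := top_variant_unfold A H). revert T. generalize (open A (TMu A)).
    clear. intros B T.
    (* The arrow and mu clauses of [proper] accept top-variants outright, and a free variable is no
       top-variant. *)
    assert (G : forall B, top_variant B = true -> proper X B).
    { clear. induction B; simpl; auto. rewrite top_variantE. discriminate. }
    auto.
Qed.

Lemma fv_open_rec k u A x : In x (fv (open_rec k u A)) -> In x (fv A) \/ In x (fv u).
Proof.
  revert k; induction A; intros k H; simpl in *; auto.
  - destruct (Nat.eqb n k); simpl in *; tauto.
  - rewrite in_app_iff in *. destruct H as [H|H];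
      [apply IHA1 in H|apply IHA2 in H]; tauto.
  - eauto.
  - eauto.
Qed.

Lemma fv_open_intro k u A x : In x (fv A) -> In x (fv (open_rec k u A)).
Proof.
  revert k; induction A; intros k H; simpl in *; auto; try tauto.
  rewrite in_app_iff in *. intuition.
Qed.

(** * Ranks and the clauses of forcing *)

(** Properness confines the index [k] to places below a bullet or inside a top-variant, where [rk]
    is 0 and does not look further. The rank may drop, since opening can create new top-variants. *)
Lemma rk_open k u A : bproper k A -> rk (open_rec k u A) <= rk A.
Proof.
  revert k; induction A; intros k H; cbn [open_rec].
  - auto.
  - simpl in H. destruct (Nat.eqb_spec n k); [contradiction|auto].
  - cbn [rk]. destruct (top_variant (TArr (open_rec k u A1) _)) eqn:E; [lia|].
    destruct (top_variant (TArr A1 A2)) eqn:E'.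
    + exfalso. rewrite top_variant_arr in *.
      rewrite (top_variant_open k u A2) in E; congruence.
    + rewrite top_variant_arr in E'. simpl in H. destruct H as [[H1 H2]|H]; [|congruence].
      specialize (IHA1 k H1). specialize (IHA2 k H2). lia.
  - cbn [rk]. destruct (top_variant _), (top_variant _); lia.
  - cbn [rk]. destruct (top_variant (TMu (open_rec (S k) u A))) eqn:E; [lia|].
    destruct (top_variant (TMu A)) eqn:E'.
    + exfalso. apply (top_variant_open k u) in E'. simpl in E'. congruence.
    + simpl in H. destruct H as [H|H]; [|congruence]. specialize (IHA (S k) H). lia.
Qed.

Lemma rk_unfold A : wf (TMu A) -> top_variant (TMu A) = false ->
  rk (open A (TMu A)) < rk (TMu A).
Proof.
  intros H T. cbn [rk]. rewrite T. apply Nat.lt_succ_r, rk_open.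
  apply wf_wfb in H; simpl in H; tauto.
Qed.

Lemma rk_arr A B : top_variant (TArr A B) = false ->
  rk A < rk (TArr A B) /\ rk B < rk (TArr A B).
Proof. intros T. cbn [rk]. rewrite T. lia. Qed.

Section Forcing.
Variables (F : LAframe) (xi : valuation F).

Lemma forces_fix p A : forces F xi p A =
  force_body F xi (p, A) (fun y _ => forces F xi (fst y) (snd y)).
Proof.
  unfold forces at 1. rewrite Fix_eq.
  - f_equal. extensionality y. extensionality h. destruct y; reflexivity.
  - intros x f g H. f_equal. extensionality y. extensionality h. apply H.
Qed.

Lemma forces_top_variant p A : top_variant A = true -> forces F xi p A.
Proof. intro H. rewrite forces_fix. simpl. rewrite H. exact I. Qed.

Lemma forces_var p X : forces F xi p (TFVar X) <-> xi X p = true.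
Proof. rewrite forces_fix. simpl. tauto. Qed.

(** The clause also covers top-variants, because the body of a boxed top-variant is again one; the
    same holds below for the codomain of an arrow and for an unfolding. *)
Lemma forces_later p A :
  forces F xi p (TLater A) <-> (forall q, succ F p q -> forces F xi q A).
Proof.
  destruct (top_variant A) eqn:E.
  - split; intros; apply forces_top_variant; auto.
  - rewrite forces_fix. unfold force_body. rewrite top_variant_later, E.
    simpl. tauto.
Qed.

Lemma forces_arr p A B : forces F xi p (TArr A B) <->
  (forall q, Rel F p q -> forces F xi q A -> forces F xi q B).
Proof.
  destruct (top_variant (TArr A B)) eqn:E.
  - split; intros; apply forces_top_variant; auto.
  - rewrite forces_fix. unfold force_body. rewrite E.
    destruct (rk_arr _ _ E).
    destruct (lt_dec (rk A) (rk (TArr A B))); [|contradiction].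
    destruct (lt_dec (rk B) (rk (TArr A B))); [|contradiction].
    simpl. tauto.
Qed.

Lemma forces_mu p A : wf (TMu A) ->
  (forces F xi p (TMu A) <-> forces F xi p (open A (TMu A))).
Proof.
  intro H. destruct (top_variant (TMu A)) eqn:E.
  - split; intros; apply forces_top_variant; auto using top_variant_unfold.
  - rewrite forces_fix. unfold force_body. rewrite E.
    assert (H' := rk_unfold _ H E).
    destruct (lt_dec (rk (open A (TMu A))) (rk (TMu A))); [|contradiction].
    simpl. tauto.
Qed.

(** Arrows and bullets are upward closed by [Rel_trans] and [fr_ax1] alone. Only mu recurses, to an
    unfolding of smaller rank. *)
Lemma forces_mono p q A : hereditary F xi -> wf A -> Rel F p q ->
  forces F xi p A -> forces F xi q A.
Proof.
  intros Hx. remember (rk A) as n eqn:E. assert (Hn : rk A <= n) by lia. clear E.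
  revert p q A Hn. induction n as [n IH] using lt_wf_ind. intros p q A Hn HA Hpq.
  destruct (top_variant A) eqn:T; [intros; apply forces_top_variant; auto|].
  destruct A.
  - rewrite !forces_var. eauto.
  - apply wf_wfb in HA; simpl in HA; lia.
  - rewrite !forces_arr. intros H r Hr. apply H. eapply Rel_trans; eauto.
  - rewrite !forces_later. intros H r Hr. apply H. eapply fr_ax1; eauto.
  - rewrite !forces_mu by auto. assert (Hrk := rk_unfold _ HA T).
    apply (IH (rk (open A (TMu A)))); auto; try lia. apply wf_unfold; auto.
Qed.

Lemma forces_later_mono p A : hereditary F xi -> wf A ->
  forces F xi p A -> forces F xi p (TLater A).
Proof.
  intros Hx HA H. rewrite forces_later. intros q Hq.
  apply (forces_mono p); auto using fr_ax2.
Qed.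

(** From right to left this is axiom L, and [fr_ax3] is made for it: the world [r] sees [q'], and
    all its successors lie above [q'], so [A] at [q'] yields [TLater A] at [r]. *)
Lemma forces_later_arr p A B : hereditary F xi -> wf A ->
  (forces F xi p (TLater (TArr A B)) <-> forces F xi p (TArr (TLater A) (TLater B))).
Proof.
  intros Hx HA. rewrite forces_later, forces_arr. split.
  - intros H q Hq. rewrite !forces_later. intros H' r Hr.
    assert (Hpr : succ F p r) by (eapply fr_ax1; eauto).
    specialize (H r Hpr). rewrite forces_arr in H. apply (H r); auto using Rel_refl.
  - intros H q Hq. rewrite forces_arr. intros q' Hq' HA'.
    destruct (fr_ax3 F p q q' Hq Hq') as (r & H1 & H2 & H3).
    specialize (H r H1). rewrite !forces_later in H. apply H; auto.
    intros s Hs. apply (forces_mono q'); auto.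
Qed.

Lemma succ_Rel p q r : succ F p q -> Rel F q r -> succ F p r.
Proof.
  intros H1 H2. destruct (fr_ax3 F p q r H1 H2) as (s & ? & ? & _).
  eapply fr_ax1; eauto.
Qed.

End Forcing.

(* Since every occurrence of a variable in which [A] is proper lies below a
   bullet, there the two valuations need to agree at the later worlds only. *)
Lemma forces_msub F (xi xi' : valuation F) (f : nat -> ty) :
  (forall x, wf (f x)) ->
  forall p A, wf A ->
  (forall X, In X (fv A) ->
    (forall q, succ F p q -> (xi' X q = true <-> forces F xi q (f X))) /\
    (~ proper X A -> forall q, Rel F p q -> (xi' X q = true <-> forces F xi q (f X)))) ->
  (forces F xi p (msub f TFVar 0 A) <-> forces F xi' p A).
Proof.
  intros Hf p A. assert (Hf' : forall x, wfb 0 (f x)) by (intro; apply wf_wfb; auto).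
  assert (Hg : forall i, wfb 0 (TFVar i)) by (simpl; auto).
  remember (p, A) as x eqn:E. revert p A E.
  induction x as [x IH] using (well_founded_induction (fw_lt_wf F)).
  intros p A -> HA Hag.
  destruct (top_variant A) eqn:T.
  { split; intros; apply forces_top_variant; auto using top_variant_msub. }
  destruct A as [X|i|A B|A|A].
  - rewrite forces_var. simpl. destruct (Hag X) as [_ H]; [simpl; auto|].
    rewrite H; [tauto|simpl; tauto|apply Rel_refl].
  - apply wf_wfb in HA; simpl in HA; lia.
  - destruct (wf_arr_inv _ _ HA) as [HA1 HB1]. destruct (rk_arr _ _ T) as [R1 R2].
    rewrite top_variant_arr in T. simpl msub. rewrite !forces_arr.
    assert (K : forall q C, Rel F p q -> C = A \/ C = B ->
      (forces F xi q (msub f TFVar 0 C) <-> forces F xi' q C)).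
    { intros q C Hq HC. eapply IH; [|reflexivity| |].
      - right; simpl; destruct HC; subst; auto.
      - destruct HC; subst; auto.
      - intros X HX. destruct (Hag X) as [H1 H2].
        { simpl; apply in_app_iff; destruct HC; subst; auto. }
        split.
        + intros r Hr. apply H1. eapply fr_ax1; eauto.
        (* As [B] is no top-variant, a component that is not proper in [X] makes the whole arrow not
           proper in [X]. *)
        + intros Hp r Hr. apply H2; [|eapply Rel_trans; eauto].
          simpl. destruct HC; subst; intros [[? ?]|?]; auto; congruence. }
    split; intros H q Hq H'; apply (K q B); auto; apply H; auto; apply (K q A); auto.
  - simpl msub. rewrite !forces_later.
    assert (K : forall q, succ F p q ->
      (forces F xi q (msub f TFVar 0 A) <-> forces F xi' q A)).
    { intros q Hq. eapply IH; [|reflexivity| |].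
      - left; auto.
      - apply wf_later_inv; auto.
      - intros X HX. destruct (Hag X HX) as [H1 _]. split.
        + intros r Hr. apply H1. eapply fr_ax1; eauto using fr_ax2.
        (* Below a bullet properness is lost, but everything above [q] is a successor of [p], where
           the valuations agree. *)
        + intros _ r Hr. apply H1. eapply succ_Rel; eauto. }
    split; intros H q Hq; apply (K q Hq); auto.
  - assert (HM : wf (TMu (msub f TFVar 1 A))).
    { apply wf_wfb. apply (wfb_msub f TFVar Hf' Hg 0 0 (TMu A)). apply wf_wfb; auto. }
    simpl msub. rewrite !forces_mu by auto.
    assert (HA' := proj1 (wf_wfb _) HA).
    replace (open (msub f TFVar 1 A) (TMu (msub f TFVar 1 A)))
      with (msub f TFVar 0 (open A (TMu A)))
      by (apply (msub_open f TFVar Hf' 0 (TMu A)); simpl in *; tauto).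
    eapply IH; [|reflexivity|apply wf_unfold; auto|].
    + right; simpl. split; [apply Rel_refl|]. apply (rk_unfold _ HA T).
    + intros X HX. destruct (Hag X) as [H1 H2].
      { apply fv_open_rec in HX; simpl in *; tauto. }
      split; auto. intros Hp. apply H2. intro; apply Hp, proper_unfold; auto.
Qed.

(** Prepares inductions along the frame: forcing [open C U] at [p] consults [U] at successors of [p]
    only, where an induction hypothesis can supply the meaning of [X]. *)
Lemma forces_open F (xi xi' : valuation F) p C U X :
  wf U -> ~ In X (fv C) -> wf (open C (TFVar X)) -> proper X (open C (TFVar X)) ->
  (forall q, succ F p q -> (xi' X q = true <-> forces F xi q U)) ->
  (forall Z, In Z (fv C) -> forall q, xi' Z q = xi Z q) ->
  (forces F xi p (open C U) <-> forces F xi' p (open C (TFVar X))).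
Proof.
  intros HU HX HC Hp Hs Ho.
  set (f := fun Z => if Nat.eqb Z X then U else TFVar Z).
  assert (Hf : forall x, wf (f x)).
  { intro x; unfold f; destruct (Nat.eqb x X); auto; constructor. }
  assert (Hf' : forall x, wfb 0 (f x)) by (intro; apply wf_wfb; auto).
  assert (HC' : wfb 1 C) by (apply (wfb_open_fvar 0 X), wf_wfb; auto).
  replace (open C U) with (msub f TFVar 0 (open C (TFVar X))).
  - apply forces_msub; auto. intros Z HZ. destruct (Nat.eq_dec Z X) as [->|NZ].
    + unfold f; rewrite Nat.eqb_refl. split; auto; tauto.
    + assert (HZ' : In Z (fv C)).
      { apply fv_open_rec in HZ. destruct HZ as [|[E|[]]]; auto; congruence. }
      unfold f. apply Nat.eqb_neq in NZ. rewrite NZ.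
      split; intros; rewrite forces_var, Ho by auto; tauto.
  - unfold open. rewrite msub_open by (simpl; auto). f_equal.
    + unfold f; simpl. rewrite Nat.eqb_refl; auto.
    + apply msub_id; auto. intros x Hx; unfold f.
      destruct (Nat.eqb_spec x X); subst; tauto.
Qed.

(** Valuations are boolean while forcing is a proposition; informative excluded middle turns any set
    of worlds into the value of a variable. *)
Definition asbool (P : Prop) : bool :=
  if excluded_middle_informative P then true else false.

Lemma asboolE P : asbool P = true <-> P.
Proof. unfold asbool; destruct (excluded_middle_informative P); intuition discriminate. Qed.

Definition upd {F} (xi : valuation F) (X : nat) (P : W F -> Prop) : valuation F :=
  fun Z q => if Nat.eqb Z X then asbool (P q) else xi Z q.

Lemma upd_eq F (xi : valuation F) X P q : upd xi X P X q = true <-> P q.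
Proof. unfold upd; rewrite Nat.eqb_refl; apply asboolE. Qed.

Lemma upd_neq F (xi : valuation F) X P Z q : Z <> X -> upd xi X P Z q = xi Z q.
Proof. intro H; unfold upd; apply Nat.eqb_neq in H; rewrite H; auto. Qed.

Lemma hereditary_upd F (xi : valuation F) X P : hereditary F xi ->
  (forall p q, Rel F p q -> P p -> P q) -> hereditary F (upd xi X P).
Proof.
  intros Hx HP Z p q Hpq. unfold upd. destruct (Nat.eqb Z X); eauto.
  rewrite !asboolE; eauto.
Qed.

Lemma wf_mu_inv A : wf (TMu A) -> exists X, ~ In X (fv A) /\
  wf (open A (TFVar X)) /\ proper X (open A (TFVar X)).
Proof. inversion 1; subst; eauto. Qed.

(** * Soundness of equality, subtyping and typing *)

Lemma teq_wf L A B : teq L A B -> wf A /\ wf B.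
Proof.
  induction 1; repeat match goal with H : _ /\ _ |- _ => destruct H end;
    split; auto using wf_top, wf_unfold, wf_arr, wf_later.
Qed.

Lemma teq_sound L A B : teq L A B -> forall F (xi : valuation F), hereditary F xi ->
  forall p, forces F xi p A <-> forces F xi p B.
Proof.
  intro HT; induction HT as [A HA|A B _ IH|A B C _ IH1 _ IH2|A B _ IH
    |A B C D _ IH1 _ IH2|A HA|A HA|A C HT IH HC|A B _ HA HB]; intros F xi Hx p.
  - tauto.
  - symmetry; auto.
  - rewrite IH1, IH2; tauto.
  - rewrite !forces_later. split; intros; apply IH; auto.
  - rewrite !forces_arr. split; intros H q Hq H'; apply (IH2 F xi Hx);
      apply H; auto; apply (IH1 F xi Hx); auto.
  - split; intros; apply forces_top_variant; reflexivity.
  - apply forces_mu; auto.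
  - destruct (teq_wf _ _ _ HT) as [HA _].
    destruct (wf_mu_inv C HC) as (X & HX & HXw & HXp).
    induction p as [p IHp] using (well_founded_induction (succ_wf F)).
    rewrite IH, forces_mu by auto.
    (* Uniqueness of guarded fixed points: [A] and [TMu C] agree at the successors of [p] by [IHp],
       so one reading of [X] serves to compare [open C A] and [open C (TMu C)] at [p]. *)
    set (xi' := upd xi X (fun q => forces F xi q A)).
    rewrite (forces_open F xi xi' p C A X), (forces_open F xi xi' p C (TMu C) X);
      auto; try tauto.
    + intros q Hq. unfold xi'. rewrite upd_eq. auto.
    + intros Z HZ q. apply upd_neq. intros ->; auto.
    + intros q Hq. unfold xi'. rewrite upd_eq. tauto.
    + intros Z HZ q. apply upd_neq. intros ->; auto.
  - apply forces_later_arr; auto.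
Qed.

Lemma sub_wf g A B : sub g A B -> wf A /\ wf B.
Proof.
  induction 1; repeat match goal with H : _ /\ _ |- _ => destruct H end;
    split; eauto using wf_top, wf_unfold, wf_arr, wf_later, wf_var.
  - apply (teq_wf true A B); auto.
  - apply (teq_wf true A B); auto.
  - apply (wf_mu A X); auto.
  - apply (wf_mu B Y); auto.
Qed.

(* For the rule on [mu X. A <= mu Y. B], [Y] is interpreted as [mu Y. B] and [X] as
   the conjunction of both sides, which satisfies the assumption [X <= Y].  By
   induction along the frame, [X] then means [mu X. A] at all later worlds. *)
Lemma sub_sound g A B : sub g A B -> forall F (xi : valuation F), hereditary F xi ->
  (forall X Y, In (X, Y) g -> forall q, xi X q = true -> xi Y q = true) ->
  forall p, forces F xi p A -> forces F xi p B.
Proof.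
  intro HS; induction HS as [g X Y _ Hin|g A _ _|g A B _ HE
    |g g1 g2 A B C _ IH1 _ IH2 _ Hg|g A B _ IH|g g1 g2 A A' B B' _ IH1 _ IH2 _ Hg
    |g g' A B X Y HXA HYB HS IH Hok Hg HXg HXB HYg HYA HpA HpB
    |g A _ HA]; intros F xi Hx Hga p.
  - rewrite !forces_var; eauto.
  - intros; apply forces_top_variant; reflexivity.
  - apply (proj1 (teq_sound true A B HE F xi Hx p)).
  - intro H. apply IH2; auto.
    + intros X Y HXY; apply Hga, Hg, in_app_iff; auto.
    + apply IH1; auto. intros X Y HXY; apply Hga, Hg, in_app_iff; auto.
  - rewrite !forces_later; auto.
  - rewrite !forces_arr. intros H q Hq H'. apply IH2; auto.
    + intros X Y HXY; apply Hga, Hg, in_app_iff; auto.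
    + apply H; auto. apply IH1; auto. intros X Y HXY; apply Hga, Hg, in_app_iff; auto.
  - destruct (sub_wf _ _ _ HS) as [HA HB]. simpl in HXA, HYB.
    assert (HMA : wf (TMu A)) by (apply (wf_mu A X); auto).
    assert (HMB : wf (TMu B)) by (apply (wf_mu B Y); auto).
    assert (NXY : X <> Y).
    { assert (Hi : In (X, Y) g') by (apply Hg; simpl; auto). apply (Hok _ _ Hi Hi). }
    assert (HYA' : ~ In Y (fv A)) by (intro; apply HYA, fv_open_intro; auto).
    assert (HXB' : ~ In X (fv B)) by (intro; apply HXB, fv_open_intro; auto).
    set (PA := fun q => forces F xi q (TMu A) /\ forces F xi q (TMu B)).
    set (PB := fun q => forces F xi q (TMu B)).
    set (xi' := upd (upd xi Y PB) X PA).
    assert (HM : forall q r C, wf C -> Rel F q r -> forces F xi q C -> forces F xi r C)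
      by (intros; eapply forces_mono; eauto).
    assert (Hx' : hereditary F xi').
    { repeat apply hereditary_upd; auto; unfold PA, PB; intuition eauto. }
    assert (HX' : forall q, xi' X q = true <-> PA q) by (intro; apply upd_eq).
    assert (HY' : forall q, xi' Y q = true <-> PB q).
    { intro q; unfold xi'; rewrite upd_neq by auto; apply upd_eq. }
    assert (HZ' : forall Z, Z <> X -> Z <> Y -> forall q, xi' Z q = xi Z q).
    { intros; unfold xi'; rewrite !upd_neq; auto. }
    induction p as [p IHp] using (well_founded_induction (succ_wf F)).
    rewrite !forces_mu by auto. intro H.
    apply (forces_open F xi xi' p B (TMu B) Y); auto.
    { intros Z HZ q. apply HZ'; intros ->; tauto. }
    apply IH; auto.
    { intros X1 Y1 H1 q. apply Hg in H1. destruct H1 as [H1|H1].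
      - inversion H1; subst. rewrite HX', HY'. unfold PA, PB; tauto.
      - rewrite !HZ'; eauto; intros ->;
          solve [apply HXg; eexists; eauto|apply HYg; eexists; eauto]. }
    apply (forces_open F xi xi' p A (TMu A) X); auto.
    + intros q Hq. rewrite HX'. unfold PA. split; [tauto|]. intro; split; auto.
    + intros Z HZ q. apply HZ'; intros ->; tauto.
  - apply forces_later_mono; auto.
Qed.

Lemma subtype_sound A B F (xi : valuation F) p : subtype A B -> hereditary F xi ->
  forces F xi p A -> forces F xi p B.
Proof. intros H Hx. apply (sub_sound _ _ _ H); auto. Qed.

(* The rule (shift) only preserves validity: a countermodel to [A] becomes one to
   [TLater A] after adding below every world [q] a copy [(q, true)] whose
   successors are the worlds above [q]. *)
Definition shift_frame (F : LAframe) : LAframe.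
Proof.
  refine {| W := W F * bool;
    succ := fun x y => snd y = false /\
      (if snd x then Rel F (fst x) (fst y) else succ F (fst x) (fst y));
    Rel := fun x y => Rel F (fst x) (fst y) /\ (snd y = true -> snd x = true) |}.
  - destruct (W_inh F) as [w]. exact (inhabits (w, true)).
  (* Every successor carries the flag [false], so dropping the first world leaves a chain of the
     original frame. *)
  - intros [f Hf]. apply (succ_nochain F). exists (fun n => fst (f (S n))).
    intro n. destruct (Hf n) as [E _]. destruct (Hf (S n)) as [_ H].
    rewrite E in H. exact H.
  - intros [p b]; simpl; auto using Rel_refl.
  - intros [p b] [q c] [r d]; simpl. intros [? ?] [? ?]; split; auto.
    eapply Rel_trans; eauto.
  - intros [p [|]] [q [|]] [r d]; simpl; intros [H1 H2] [H3 H4]; split; auto.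
    + eapply Rel_trans; eauto.
    + eapply Rel_trans; eauto using fr_ax2.
    + discriminate (H2 eq_refl).
    + eapply fr_ax1; eauto.
  - intros [p [|]] [q c]; simpl; intros [-> H]; split; auto using fr_ax2.
  - intros [p b] [q c] [q' c']; simpl. intros [-> H] [H1 H2].
    destruct c'; [discriminate (H2 eq_refl)|]. destruct b.
    (* The copy of [q'] sees exactly the original worlds above [q'], as the third frame condition
       demands. *)
    + exists (q', true); simpl. split; [split; auto; eapply Rel_trans; eauto|].
      split; [auto using Rel_refl|]. intros [s d] [E Hs]; simpl in *; subst; auto.
    + destruct (fr_ax3 F p q q' H H1) as (r & R1 & R2 & R3).
      exists (r, false); simpl. split; [auto|]. split; [auto|].
      intros [s d] [E Hs]; simpl in *; subst; auto.
Defined.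

(** A copy lies above copies only, so making every variable false there keeps the valuation
    hereditary. *)
Definition shift_val {F} (xi : valuation F) : valuation (shift_frame F) :=
  fun X x => if snd (x : W F * bool) then false else xi X (fst x).

Lemma hereditary_shift F (xi : valuation F) :
  hereditary F xi -> hereditary (shift_frame F) (shift_val xi).
Proof.
  intros Hx X [p b] [q c] [H1 H2]; unfold shift_val; simpl in *.
  destruct b; [discriminate|]. destruct c; [discriminate (H2 eq_refl)|]. eauto.
Qed.

(** The original worlds form a generated subframe: neither relation leads from them to a copy. *)
Lemma forces_shift_false F (xi : valuation F) p A : wf A ->
  (forces (shift_frame F) (shift_val xi) (p, false) A <-> forces F xi p A).
Proof.
  remember (p, A) as x eqn:E. revert p A E.
  induction x as [x IH] using (well_founded_induction (fw_lt_wf F)).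
  intros p A -> HA.
  destruct (top_variant A) eqn:T; [split; intros; apply forces_top_variant; auto|].
  destruct A as [X|i|A B|A|A].
  - rewrite !forces_var. reflexivity.
  - apply wf_wfb in HA; simpl in HA; lia.
  - destruct (wf_arr_inv _ _ HA) as [HA1 HB1]. destruct (rk_arr _ _ T) as [R1 R2].
    assert (K : forall q C, Rel F p q -> C = A \/ C = B ->
      (forces (shift_frame F) (shift_val xi) (q, false) C <-> forces F xi q C)).
    { intros q C Hq HC. eapply IH; [|reflexivity|].
      - right; simpl; destruct HC; subst; auto.
      - destruct HC; subst; auto. }
    rewrite !forces_arr. split.
    + intros H q Hq. rewrite <- !K by auto. apply H. split; simpl; auto.
    + intros H [q c] [Hq Hc]. simpl in *. destruct c; [discriminate (Hc eq_refl)|].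
      rewrite !K by auto. auto.
  - assert (K : forall q, succ F p q ->
      (forces (shift_frame F) (shift_val xi) (q, false) A <-> forces F xi q A)).
    { intros q Hq. eapply IH; [|reflexivity|].
      - left; auto.
      - apply wf_later_inv; auto. }
    rewrite !forces_later. split.
    + intros H q Hq. rewrite <- K by auto. apply H. split; auto.
    + intros H [q c] [Hc Hq]. simpl in *. subst. rewrite K by auto. auto.
  - rewrite !forces_mu by auto. eapply IH; [|reflexivity|].
    + right; simpl. split; [apply Rel_refl|]. apply rk_unfold; auto.
    + apply wf_unfold; auto.
Qed.

Lemma forces_shift_true F (xi : valuation F) p A : hereditary F xi -> wf A ->
  (forces (shift_frame F) (shift_val xi) (p, true) (TLater A) <-> forces F xi p A).
Proof.
  intros Hx HA. rewrite forces_later. split.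
  - intro H. apply forces_shift_false; auto. apply H. split; simpl; auto using Rel_refl.
  - intros H [q c] [Hc Hq]. simpl in *. subst.
    apply forces_shift_false; auto. eapply forces_mono; eauto.
Qed.

Lemma typing_wf G M A : typing G M A -> ctx_ok G /\ wf A.
Proof.
  induction 1 as [G x A HG Hx|G G' M A _ IH Hl|G M HG HM|G M A B _ IH HS
    |G G' M x A B _ _ IH Hc Hu|G G1 G2 M N A B _ IH1 _ IH2 Hc Hu].
  - split; auto. apply HG in Hx; auto.
  - destruct IH as [[[l Hl1] Hl2] IH2]. split; [|apply wf_later_inv; auto]. split.
    + exists l. intros x Hx. apply Hl1. rewrite Hl. unfold ctx_later.
      destruct (G x); simpl; congruence.
    + intros x C Hx. apply wf_later_inv. apply (Hl2 x). rewrite Hl. unfold ctx_later.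
      rewrite Hx; auto.
  - auto using wf_top.
  - split; [tauto|]. apply sub_wf in HS; tauto.
  - destruct IH as [[[l Hl1] Hl2] IH2].
    assert (HG : forall y C, G y = Some C -> G' y = Some C).
    { intros y C Hy. rewrite Hu. unfold ctx_union. rewrite Hy; auto. }
    assert (HA : G' x = Some A).
    { rewrite Hu. unfold ctx_union, ctx_single in *.
      destruct (G x) eqn:E; [f_equal|rewrite Nat.eqb_refl; auto].
      apply (Hc x); auto. unfold ctx_single; rewrite Nat.eqb_refl; auto. }
    split.
    + split; [exists l|].
      * intros y Hy. destruct (G y) eqn:E; [|congruence]. apply Hl1.
        rewrite (HG y t); congruence.
      * intros; eapply Hl2; eauto.
    + apply wf_arr; eauto.
  - destruct IH1 as [[[l1 H1] H1'] HAB]. destruct IH2 as [[[l2 H2] H2'] _].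
    apply wf_arr_inv in HAB. split; [|tauto]. split.
    + exists (l1 ++ l2). intros x. rewrite in_app_iff, Hu. unfold ctx_union.
      specialize (H1 x). specialize (H2 x). destruct (G1 x); auto.
    + intros x C. rewrite Hu. unfold ctx_union.
      specialize (H1' x). specialize (H2' x). destruct (G1 x); eauto.
Qed.

Lemma typing_sound G M A : typing G M A ->
  forall F (xi : valuation F), hereditary F xi ->
  forall p, (forall x C, G x = Some C -> forces F xi p C) -> forces F xi p A.
Proof.
  induction 1 as [G x A HG HGx|G G' M A HT IH Hl|G M HG HM|G M A B HT IH HS
    |G G' M x A B _ HT IH Hc Hu|G G1 G2 M N A B HT1 IH1 HT2 IH2 Hc Hu];
    intros F xi Hx p Hp.
  - eauto.
  - apply typing_wf in HT as [HG' HA]. apply wf_later_inv in HA.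
    (* The induction hypothesis is used in the extended frame, which is why frame and valuation are
       quantified inside the induction. *)
    apply forces_shift_true; auto. apply IH; auto using hereditary_shift.
    intros x C HC. assert (HCw : wf C) by (eapply HG'; eauto).
    rewrite Hl in HC. unfold ctx_later in HC.
    destruct (G x) as [D|] eqn:E; simpl in HC; inversion HC; subst.
    apply forces_shift_true; auto; [apply wf_later_inv; auto|eauto].
  - apply forces_top_variant; reflexivity.
  - eapply subtype_sound; eauto.
  - apply typing_wf in HT as [HG' _]. rewrite forces_arr. intros q Hq HAq.
    apply IH; auto. intros y C HC. assert (HCw : wf C) by (eapply HG'; eauto).
    rewrite Hu in HC. unfold ctx_union, ctx_single in HC.
    destruct (G y) eqn:E.
    + inversion HC; subst. eapply forces_mono; eauto.
    + destruct (Nat.eqb y x); inversion HC; subst; auto.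
  - assert (HAB : forces F xi p (TArr A B)).
    { apply IH1; auto. intros x C HC. apply (Hp x). rewrite Hu. unfold ctx_union.
      rewrite HC; auto. }
    rewrite forces_arr in HAB. apply HAB; [apply Rel_refl|].
    apply IH2; auto. intros x C HC. apply (Hp x). rewrite Hu. unfold ctx_union.
    destruct (G1 x) eqn:E; auto. f_equal. eapply Hc; eauto.
Qed.

(** * Derived rules of LAmu *)

Lemma LAmu_wf G A : LAmu G A -> (forall C, In C G -> wf C) /\ wf A.
Proof.
  induction 1 as [G A HG HA|G G1 G2 A _ [IHG IHA] H2 HG|G A _ [IHG IHA]
    |G G' A B _ [IHG IHB] HG|G G1 G2 A B _ [IHG1 IHAB] _ [IHG2 _] HG
    |G A HA _ [IHG _]|G A _ [IHG IHA]|G A B _ [IHG IHAB]|G A _ [IHG IHA]];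
    split; auto using wf_later, wf_unfold.
  - intros C HC. apply HG, in_app_iff in HC. destruct HC as [HC|HC]; auto.
    apply in_map_iff in HC. destruct HC as (D & <- & HD). apply wf_later; auto.
  - intros C HC. apply IHG, HG; simpl; auto.
  - apply wf_arr; auto. apply IHG, HG; simpl; auto.
  - intros C HC. apply HG, in_app_iff in HC. intuition.
  - apply wf_arr_inv in IHAB; tauto.
  - apply wf_arr_inv in IHAB. destruct IHAB.
    apply wf_later, wf_arr; apply wf_later_inv; auto.
Qed.

Lemma LAmu_weaken G G' A : LAmu G A -> (forall C, In C G -> In C G') ->
  (forall C, In C G' -> wf C) -> LAmu G' A.
Proof.
  intro H; revert G'. induction H as [G A HG HA|G G1 G2 A _ IH H2 HG|G A _ IH
    |G G' A B H IH HG|G G1 G2 A B _ IH1 _ IH2 HG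
    |G A HA _ IH|G A _ IH|G A B _ IH|G A _ IH]; intros G0 Hi Hw.
  - apply LA_assump; auto.
  (* All of [G0] is taken as the side context; its overlap with [map TLater G1] is harmless because
     contexts are compared as sets. *)
  - apply (LA_nec G0 G1 G0); auto.
    + apply IH; auto. intros C HC. apply wf_later_inv, Hw, Hi, HG, in_app_iff.
      left. apply in_map; auto.
    + intro C. rewrite in_app_iff. split; auto. intros [HC|HC]; auto.
      apply Hi, HG, in_app_iff; auto.
  - apply LA_4; auto.
  - apply (LA_impI G0 (A :: G0)); [|intro; tauto]. apply IH.
    + intros C HC. apply HG in HC. simpl in *. intuition.
    + intros C [<-|HC]; auto. apply (proj1 (LAmu_wf _ _ H)), HG; simpl; auto.
  - apply (LA_impE G0 G0 G0 A); auto.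
    + apply IH1; auto. intros C HC; apply Hi, HG, in_app_iff; auto.
    + apply IH2; auto. intros C HC; apply Hi, HG, in_app_iff; auto.
    + intro C; rewrite in_app_iff; tauto.
  - apply LA_fold; auto.
  - apply LA_unfold; auto.
  - apply LA_L; auto.
  - apply LA_approx; auto.
Qed.

Lemma LAmu_intro G A B : LAmu (A :: G) B -> LAmu G (TArr A B).
Proof. intro H. apply (LA_impI G (A :: G)); auto. intro; tauto. Qed.

Lemma LAmu_mp G A B : LAmu G (TArr A B) -> LAmu G A -> LAmu G B.
Proof.
  intros H1 H2. apply (LA_impE G G G A); auto. intro C; rewrite in_app_iff; tauto.
Qed.

Lemma LAmu_cut l G A : LAmu l A -> (forall C, In C l -> LAmu G C) ->
  (forall C, In C G -> wf C) -> LAmu G A.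
Proof.
  intros H Hl Hw. revert A H. induction l as [|C l IH]; intros A H.
  - apply (LAmu_weaken []); auto. simpl; tauto.
  - apply (LAmu_mp G C); [|apply Hl; simpl; auto].
    apply IH; [|apply LAmu_intro; auto]. intros; apply Hl; simpl; auto.
Qed.

Lemma LAmu_nec l A : LAmu l A -> LAmu (map TLater l) (TLater A).
Proof.
  intro H. apply (LA_nec _ l []); auto; [simpl; tauto|].
  intro; rewrite app_nil_r; tauto.
Qed.

Lemma LAmu_K G A B : LAmu G (TLater (TArr A B)) -> LAmu G (TLater A) ->
  LAmu G (TLater B).
Proof.
  intros H1 H2. destruct (LAmu_wf _ _ H1) as [HG HAB]. apply wf_later_inv in HAB.
  destruct (wf_arr_inv _ _ HAB) as [HA HB].
  apply (LAmu_cut (map TLater [TArr A B; A])); auto.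
  - apply LAmu_nec. assert (Hw : forall C, In C [TArr A B; A] -> wf C)
      by (intros C [<-|[<-|[]]]; auto).
    apply (LAmu_mp _ A); apply LA_assump; simpl; auto.
  - intros C [<-|[<-|[]]]; auto.
Qed.

(* Curry's fixed point combinator, typed with [Y = TMu (TLater Y -> A)]. *)
Lemma LAmu_Loeb G A : LAmu (TLater A :: G) A -> LAmu G A.
Proof.
  intro H. destruct (LAmu_wf _ _ H) as [HG HA].
  assert (HG' : forall C, In C G -> wf C) by (intros; apply HG; simpl; auto).
  assert (HA' := proj1 (wf_wfb A) HA).
  set (Y := TMu (TArr (TLater (TBVar 0)) A)).
  assert (HY : wf Y).
  { apply wf_wfb; simpl. repeat split; auto; [apply (wfb_mono 0); auto|].
    left; split; auto. apply (bproper_closed 0); auto. }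
  assert (HYo : open (TArr (TLater (TBVar 0)) A) Y = TArr (TLater Y) A).
  { unfold open; simpl. f_equal. apply (open_rec_closed 0); auto. }
  assert (HYG : LAmu G Y).
  { apply LA_fold; auto. fold Y. rewrite HYo. apply LAmu_intro.
    assert (Hw : forall C, In C (TLater Y :: G) -> wf C)
      by (intros C [<-|HC]; auto using wf_later).
    assert (HlY : LAmu (TLater Y :: G) (TLater Y)) by (apply LA_assump; simpl; auto).
    apply (LAmu_mp _ (TLater A)).
    - apply LAmu_intro. apply (LAmu_weaken (TLater A :: G)); auto.
      + simpl; intuition.
      + intros C [<-|HC]; auto using wf_later.
    (* Self-application under the bullet: necessitation of the unfolding turns [TLater Y] into
       [TLater (TLater Y -> A)], and rule 4 supplies its argument [TLater (TLater Y)]. *)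
    - apply (LAmu_K _ (TLater Y)); [|apply LA_4; auto].
      rewrite <- HYo. apply (LAmu_cut [TLater Y]); auto.
      + apply (LAmu_nec [Y]), LA_unfold, LA_assump; simpl; auto.
        intros C [<-|[]]; auto.
      + intros C [<-|[]]; auto. }
  apply (LAmu_mp _ (TLater Y)).
  - rewrite <- HYo. apply LA_unfold; auto.
  - apply LA_approx; auto.
Qed.

(** * Closed instances of subexpressions *)

(** The default is an arbitrary closed type, which makes the environment total with closed
    values. *)
Definition env_sub (sg : list ty) (i : nat) : ty := nth i sg (TFVar 0).

Definition inst (sg : list ty) (k : nat) (A : ty) : ty := msub TFVar (env_sub sg) k A.

Lemma env_sub_closed sg : (forall C, In C sg -> wf C) ->
  forall i, wfb 0 (env_sub sg i).
Proof.
  intros H i. unfold env_sub. destruct (nth_in_or_default i sg (TFVar 0)) as [Hi|Hi].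
  - apply wf_wfb; auto.
  - rewrite Hi; simpl; auto.
Qed.

Lemma inst_wf sg n A : (forall C, In C sg -> wf C) -> wfb n A -> wf (inst sg 0 A).
Proof.
  intros H HA. apply wf_wfb. apply (wfb_msub TFVar (env_sub sg)) with (m := n); auto.
  - simpl; auto.
  - apply env_sub_closed; auto.
Qed.

Lemma inst_mu sg A : (forall C, In C sg -> wf C) ->
  open (inst sg 1 A) (TMu (inst sg 1 A)) = inst (TMu (inst sg 1 A) :: sg) 0 A.
Proof.
  intro H. unfold open, inst. rewrite open_msub.
  - reflexivity.
  - simpl; auto.
  - apply env_sub_closed; auto.
Qed.

Lemma inst_nil A : wf A -> inst [] 0 A = A.
Proof. intro H. apply msub_id; auto. apply wf_wfb; auto. Qed.

(** Follows the tail of a top-variant. At a binder, Loeb's rule provides the assumption [TLater X]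
    for its instance [X]. The first bullet crossed afterwards turns it into [X] itself, and this is
    recorded by a count of at least 1 in [env]. Reaching the index of such a binder ends the
    derivation. *)
Lemma LAmu_tv_rec A : forall n env sg G, wfb n A -> (forall C, In C sg -> wf C) ->
  (forall C, In C G -> wf C) ->
  (forall i m, nth_error env i = Some m -> LAmu G (TLater (env_sub sg i)) /\
     i < length sg /\ (1 <= m -> LAmu G (env_sub sg i))) ->
  tv_rec A env = true -> LAmu G (inst sg 0 A).
Proof.
  induction A as [x|i|A _ B IH|A IH|A IH]; intros n env sg G HA Hsg HG He H; simpl in H.
  - discriminate.
  - unfold inst; simpl. rewrite Nat.sub_0_r.
    destruct (nth_error env i) as [m|] eqn:E; [|discriminate].
    apply (He i m); auto. destruct m; [discriminate|lia].
  - simpl in HA. apply LAmu_intro.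
    assert (Hw : forall C, In C (inst sg 0 A :: G) -> wf C).
    { intros C [<-|HC]; auto. apply (inst_wf sg n); tauto. }
    apply (IH n env); try tauto.
    intros i m Hi. destruct (He i m Hi) as (H1 & H2 & H3).
    repeat split; auto; [|intro Hm; specialize (H3 Hm)];
      eapply LAmu_weaken; eauto; simpl; auto.
  (* The context under the bullet consists of those binder instances whose boxed forms [G] derives;
     necessitation and cut lead back to [G]. *)
  - apply (LAmu_cut (map TLater (filter (fun C => asbool (LAmu G (TLater C))) sg))); auto.
    + apply LAmu_nec. change (LAmu (filter (fun C => asbool (LAmu G (TLater C))) sg)
        (inst sg 0 A)).
      assert (Hw : forall C, In C (filter (fun C => asbool (LAmu G (TLater C))) sg) -> wf C).
      { intros C HC; apply filter_In in HC; apply Hsg; tauto. }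
      apply (IH n (map S env)); auto.
      intros i m Hi. rewrite nth_error_map in Hi.
      destruct (nth_error env i) as [m'|] eqn:E; [|discriminate].
      destruct (He i m' E) as (H1 & H2 & H3).
      assert (HL : LAmu (filter (fun C => asbool (LAmu G (TLater C))) sg) (env_sub sg i)).
      { apply LA_assump; auto. apply filter_In. rewrite asboolE. split; auto.
        apply nth_In; auto. }
      repeat split; auto using LA_approx.
    + intros C HC. apply in_map_iff in HC. destruct HC as (D & <- & HD).
      apply filter_In in HD. rewrite asboolE in HD. tauto.
  - assert (HX : wf (inst sg 0 (TMu A))) by (apply (inst_wf sg n); auto).
    apply LAmu_Loeb. simpl in HA. change (inst sg 0 (TMu A)) with (TMu (inst sg 1 A)) in *.
    apply LA_fold; auto. rewrite inst_mu by auto.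
    set (X := TMu (inst sg 1 A)) in *.
    assert (Hw : forall C, In C (TLater X :: G) -> wf C).
    { intros C [<-|HC]; auto using wf_later. }
    apply (IH (S n) (0 :: env)); try tauto.
    { intros C [<-|HC]; auto. }
    intros [|i] m Hi; simpl in Hi.
    + inversion Hi; subst. repeat split; simpl; try lia.
      apply LA_assump; simpl; auto.
    + destruct (He i m Hi) as (H1 & H2 & H3).
      repeat split; simpl; [|lia|intro Hm; specialize (H3 Hm)];
        eapply LAmu_weaken; eauto; simpl; auto.
Qed.

Lemma LAmu_top_variant G A : (forall C, In C G -> wf C) -> wf A ->
  top_variant A = true -> LAmu G A.
Proof.
  intros HG HA. rewrite top_variantE. rewrite <- (inst_nil A HA) at 2.
  apply (LAmu_tv_rec A 0); auto.
  - apply wf_wfb; auto.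
  - simpl; tauto.
  - intros [|] ? ?; discriminate.
Qed.

(* The analogue for equirecursive types of the list of subformulas: every bound
   variable stands for the closed instance of its binder. *)
Fixpoint subforms (sg : list ty) (A : ty) : list ty :=
  inst sg 0 A ::
  match A with
  | TFVar _ | TBVar _ => []
  | TArr A1 A2 => subforms sg A1 ++ subforms sg A2
  | TLater A1 => subforms sg A1
  | TMu A1 => subforms (inst sg 0 (TMu A1) :: sg) A1
  end.

Definition decomposable (L : list ty) (A : ty) : Prop :=
  match A with
  | TArr A1 A2 => In A1 L /\ In A2 L
  | TLater A1 => In A1 L
  | TMu A1 => In (open A1 (TMu A1)) L
  | _ => True
  end.

Lemma subforms_head sg A : In (inst sg 0 A) (subforms sg A).
Proof. destruct A; simpl; auto. Qed.

Lemma subforms_wf A : forall sg n, wfb n A -> (forall C, In C sg -> wf C) ->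
  forall C, In C (subforms sg A) -> wf C.
Proof.
  induction A as [x|i|A IHA B IHB|A IH|A IH]; intros sg n HA Hw C HC;
    (destruct HC as [<-|HC]; [apply (inst_wf sg n); auto|]); simpl in HA, HC; try tauto.
  - apply in_app_iff in HC. destruct HC; [apply (IHA sg n)|apply (IHB sg n)]; tauto.
  - apply (IH sg n); auto.
  - apply (IH (inst sg 0 (TMu A) :: sg) (S n)); try tauto.
    intros D [<-|HD]; auto. apply (inst_wf sg n); auto.
Qed.

(** A finite list suffices since unfolding the instance of a mu gives the instance of its body in
    the extended environment ([inst_mu]), while a bound variable leads back to the instance of its
    binder in [sg]. *)
Lemma subforms_decomposable L A : forall sg n, wfb n A -> (forall C, In C sg -> wf C) ->
  (forall C, In C sg -> decomposable L C) ->
  (forall C, In C (subforms sg A) -> In C L) ->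
  forall C, In C (subforms sg A) -> decomposable L C.
Proof.
  induction A as [x|i|A IHA B IHB|A IH|A IH];
    intros sg n HA Hw Hsg HL C HC; simpl in HA, HL, HC.
  - destruct HC as [<-|[]]; simpl; auto.
  - destruct HC as [<-|[]]. unfold inst; simpl. rewrite Nat.sub_0_r. unfold env_sub.
    destruct (nth_in_or_default i sg (TFVar 0)) as [H|H]; auto. rewrite H; simpl; auto.
  - destruct HC as [<-|HC].
    + split; apply HL; right; apply in_app_iff; [left|right]; apply subforms_head.
    + apply in_app_iff in HC. destruct HC as [HC|HC]; [apply (IHA sg n)|apply (IHB sg n)];
        try tauto; intros; apply HL; right; apply in_app_iff; auto.
  - destruct HC as [<-|HC].
    + apply HL; right; apply subforms_head.
    + apply (IH sg n); auto.
  - assert (HX : decomposable L (inst sg 0 (TMu A))).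
    { simpl. change (In (open (inst sg 1 A) (TMu (inst sg 1 A))) L).
      rewrite inst_mu by auto. apply HL; right. apply subforms_head. }
    destruct HC as [<-|HC]; auto.
    apply (IH (inst sg 0 (TMu A) :: sg) (S n)); try tauto.
    + intros D [<-|HD]; auto. apply (inst_wf sg n); auto.
    + intros D [<-|HD]; auto.
    + intros; apply HL; auto.
Qed.

(** * The canonical model *)

Definition derives (S : ty -> Prop) (A : ty) : Prop :=
  exists l, (forall C, In C l -> S C) /\ LAmu l A.

(** Plain deductive closure suffices for a canonical world, the language having neither disjunction
    nor falsity as a connective. *)
Definition theory (p : ty -> Prop) : Prop :=
  (forall A, p A -> wf A) /\ (forall A, derives p A -> p A).

Lemma derives_theory (S : ty -> Prop) : (forall A, S A -> wf A) -> theory (derives S).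
Proof.
  intro HS. split.
  - intros A (l & _ & H). apply LAmu_wf in H; tauto.
  - intros A (l & Hl & H). revert A H. induction l as [|C l IH]; intros A H.
    + exists []; split; [simpl; tauto|auto].
    + destruct (Hl C) as (l1 & Hl1 & H1); [simpl; auto|].
      destruct (IH (fun D HD => Hl D (or_intror HD)) _ (LAmu_intro _ _ _ H))
        as (l2 & Hl2 & H2).
      exists (l2 ++ l1). split.
      * intros D HD. apply in_app_iff in HD. destruct HD; auto.
      * apply (LA_impE _ l2 l1 C); auto. intro; tauto.
Qed.

Lemma derives_base (S : ty -> Prop) A : S A -> wf A -> derives S A.
Proof.
  intros H HA. exists [A]. split; [intros C [<-|[]]; auto|].
  apply LA_assump; [intros C [<-|[]]; auto|simpl; auto].
Qed.

Lemma derives_mono (S S' : ty -> Prop) A :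
  (forall C, S C -> S' C) -> derives S A -> derives S' A.
Proof. intros H (l & Hl & HA). exists l; auto. Qed.

Lemma derives_intro (S : ty -> Prop) A B : wf A -> (forall C, S C -> wf C) ->
  derives (fun C => C = A \/ S C) B -> derives S (TArr A B).
Proof.
  intros HA HS (l & Hl & H).
  assert (E : exists l', (forall C, In C l' -> S C) /\
    (forall C, In C l -> In C (A :: l'))).
  { clear H. induction l as [|D l IH].
    - exists []; simpl; tauto.
    - destruct IH as (l' & H1 & H2); [intros; apply Hl; simpl; auto|].
      destruct (Hl D) as [->|HD]; [simpl; auto| |].
      + exists l'; split; auto. intros C [<-|HC]; simpl; auto. apply H2; auto.
      + exists (D :: l'). split.
        * intros C [<-|HC]; auto.
        * intros C [<-|HC]; simpl; auto. apply H2 in HC. simpl in HC; tauto. }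
  destruct E as (l' & H1 & H2). exists l'. split; auto. apply LAmu_intro.
  apply (LAmu_weaken l); auto. intros C [<-|HC]; auto.
Qed.

Lemma theory_mp p A B : theory p -> p (TArr A B) -> p A -> p B.
Proof.
  intros [Hw Hp] H1 H2. apply Hp. exists [TArr A B; A]. split.
  - intros C [<-|[<-|[]]]; auto.
  - assert (H : forall C, In C [TArr A B; A] -> wf C) by (intros C [<-|[<-|[]]]; auto).
    apply (LAmu_mp _ A); apply LA_assump; simpl; auto.
Qed.

Lemma theory_rule p A B : theory p -> LAmu [A] B -> p A -> p B.
Proof.
  intros [Hw Hp] H HA. apply Hp. exists [A]. split; auto. intros C [<-|[]]; auto.
Qed.

Lemma LAmu_self A : wf A -> LAmu [A] A.
Proof. intro H. apply LA_assump; [intros C [<-|[]]; auto|simpl; auto]. Qed.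

Lemma theory_later p A : theory p -> p A -> p (TLater A).
Proof.
  intros Hp HA. apply (theory_rule p A); auto. apply LA_approx, LAmu_self, Hp; auto.
Qed.

(* By Loeb's rule, [TLater A] may be added to the bodies of the boxed formulas of
   [p] without deriving [A]. *)
Definition next (p : ty -> Prop) (A : ty) : ty -> Prop :=
  derives (fun C => C = TLater A \/ p (TLater C)).

Lemma next_theory p A : theory p -> wf A -> theory (next p A).
Proof.
  intros Hp HA. apply derives_theory. intros C [->|HC]; [apply wf_later; auto|].
  apply wf_later_inv, Hp; auto.
Qed.

Lemma next_sub p A C : theory p -> p (TLater C) -> next p A C.
Proof. intros Hp HC. apply derives_base; auto. apply wf_later_inv, Hp; auto. Qed.

Lemma next_refutes p A : theory p -> wf A -> ~ p (TLater A) -> ~ next p A A.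
Proof.
  intros Hp HA Hn H. apply Hn.
  apply derives_intro in H; [|apply wf_later; auto|intros C HC; apply wf_later_inv, Hp; auto].
  destruct H as (l & Hl & H). apply Hp. exists (map TLater l). split.
  - intros C HC. apply in_map_iff in HC. destruct HC as (D & <- & HD); auto.
  - apply LAmu_nec, LAmu_Loeb. destruct (LAmu_wf _ _ H) as [Hw _].
    assert (Hw' : forall C, In C (TLater A :: l) -> wf C).
    { intros C [<-|HC]; auto using wf_later. }
    apply (LAmu_mp _ (TLater A)).
    + apply (LAmu_weaken l); simpl; auto.
    + apply LA_assump; simpl; auto.
Qed.

(* [height L n p]: the chains [p, next p A1, next (next p A1) A2, ...] which refute
   a formula of [L] at each step have at most [n] steps. *)
Fixpoint height (L : list ty) (n : nat) (p : ty -> Prop) : Prop :=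
  forall A, In (TLater A) L -> ~ p (TLater A) ->
  match n with 0 => False | S m => height L m (next p A) end.

(** A larger theory lacks fewer boxed formulas, and [next] preserves inclusion. New worlds obtain
    their bounds in this way. *)
Lemma height_mono L n (p q : ty -> Prop) : (forall C, p C -> q C) ->
  height L n p -> height L n q.
Proof.
  revert p q; induction n as [|n IH]; intros p q Hpq H A HA Hn.
  - apply (H A); auto.
  - apply (IH (next p A)); [|apply (H A); auto].
    intro C; apply derives_mono; intuition.
Qed.

(** Each step to [next p A] puts [TLater A] into the theory, and boxed formulas once present stay,
    since rule (approx) puts a second bullet on them. So every step uses up an entry of [l], which
    contains all boxed formulas of [L] still missing. *)
Lemma theory_height L : (forall C, In C L -> wf C) ->
  forall p, theory p -> height L (length L) p.
Proof.
  intros HL.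
  assert (H : forall n l p, length l = n -> theory p ->
    (forall A, In (TLater A) L -> ~ p (TLater A) -> In (TLater A) l) -> height L n p).
  { induction n as [|n IH]; intros l p El Hp Hl A HA Hn; assert (HAl := Hl A HA Hn).
    - destruct l; [destruct HAl|discriminate].
    - apply in_split in HAl. destruct HAl as (l1 & l2 & ->).
      rewrite length_app in El; simpl in El.
      assert (HwA : wf A) by (apply wf_later_inv; auto).
      apply (IH (l1 ++ l2)).
      + rewrite length_app; lia.
      + apply next_theory; auto.
      + intros B HB HBn. assert (HwB : wf (TLater B)) by auto.
        assert (HBl : In (TLater B) (l1 ++ TLater A :: l2)).
        { apply Hl; auto. intro HBp. apply HBn, next_sub; auto. apply theory_later; auto. }
        apply in_app_iff in HBl. apply in_app_iff. destruct HBl as [?|[E|?]]; auto.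
        exfalso. apply HBn. rewrite <- E. apply derives_base; auto using wf_later. }
  intros p Hp. apply (H (length L) L); auto.
Qed.

(** Any bound on the height may accompany a theory. This freedom is used when worlds are built: an
    extension of [p] keeps the number of [p], and the third frame condition calls for
    [S (lev q')]. *)
Definition cworld (L : list ty) : Type :=
  {x : nat * (ty -> Prop) | theory (snd x) /\ height L (fst x) (snd x)}.

Definition lev {L} (w : cworld L) : nat := fst (proj1_sig w).
Definition thy {L} (w : cworld L) : ty -> Prop := snd (proj1_sig w).

Definition mkworld {L} n p (Hp : theory p) (Hh : height L n p) : cworld L :=
  exist _ (n, p) (conj Hp Hh).

Lemma thyP {L} (w : cworld L) : theory (thy w).
Proof. exact (proj1 (proj2_sig w)). Qed.

Lemma levP {L} (w : cworld L) : height L (lev w) (thy w).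
Proof. exact (proj2 (proj2_sig w)). Qed.

(* This is where axiom L enters: it moves the premises [TLater E] inside the box. *)
Lemma derives_later_theory (p q : ty -> Prop) : theory p -> theory q ->
  (forall C, p (TLater C) -> q C) ->
  (* The premises are kept as [l ++ lp], where [lp] collects those known to lie in [p]. Each head of
     [l] either moves to [lp] or, being some [TLater E], is absorbed into the conclusion as
     [TLater (E -> D)]. *)
  forall D, derives (fun C => p C \/ exists E, C = TLater E /\ q E) (TLater D) -> q D.
Proof.
  intros Hp Hq Hpq D (l & Hl & H). rewrite <- (app_nil_r l) in H.
  assert (Hn : forall C, In C (@nil ty) -> p C) by (simpl; tauto).
  revert H Hn. generalize (@nil ty) as lp. revert D.
  induction l as [|C l IH]; intros D lp H Hlp.
  - apply Hpq, Hp. exists lp; auto.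
  - assert (Hl' : forall C, In C l -> p C \/ exists E, C = TLater E /\ q E)
      by (intros; apply Hl; simpl; auto).
    destruct (LAmu_wf _ _ H) as [Hw _].
    destruct (Hl C) as [HC|(E & -> & HE)]; [simpl; auto| |].
    + apply (IH Hl' D (C :: lp)).
      * apply (LAmu_weaken _ _ _ H).
        -- intro X. simpl. rewrite !in_app_iff. simpl. tauto.
        -- intros X HX. apply Hw. rewrite in_app_iff in HX. simpl in *.
           rewrite in_app_iff. tauto.
      * intros X [<-|HX]; auto.
    + apply (theory_mp q E D Hq); auto. apply (IH Hl' _ lp); auto.
      apply LA_L, LAmu_intro, H.
Qed.

(** The witness is generated by [p] and the boxed formulas of [q']. It contains [TLater C] exactly
    when [q'] contains [C], so its successors are the worlds above [q'] once its number is
    [S (lev q')]; this is at most [lev p] because [lev q' <= lev q < lev p]. *)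
Lemma cframe_ax3 L (p q q' : cworld L) :
  (lev q < lev p /\ forall C, thy p (TLater C) -> thy q C) ->
  (lev q' <= lev q /\ forall C, thy q C -> thy q' C) ->
  exists r : cworld L, (lev r <= lev p /\ forall C, thy p C -> thy r C) /\
    (lev q' < lev r /\ forall C, thy r (TLater C) -> thy q' C) /\
    (forall s : cworld L, lev s < lev r /\ (forall C, thy r (TLater C) -> thy s C) ->
      lev s <= lev q' /\ forall C, thy q' C -> thy s C).
Proof.
  intros [Hl Hpq] [Hl' Hqq].
  set (r := derives (fun C => thy p C \/ exists E, C = TLater E /\ thy q' E)).
  assert (Hr : theory r).
  { apply derives_theory. intros C [HC|(E & -> & HE)].
    - apply (thyP p); auto.
    - apply wf_later, (thyP q'); auto. }
  assert (Hr1 : forall C, r (TLater C) -> thy q' C).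
  { apply derives_later_theory; auto using thyP. }
  assert (Hr2 : forall C, thy q' C -> r (TLater C)).
  { intros C HC. apply derives_base; [eauto|]. apply wf_later, (thyP q'); auto. }
  assert (Hh : height L (S (lev q')) r).
  { intros A HA Hn. apply (height_mono L _ (thy q')); [|apply levP].
    intros C HC. apply next_sub; auto. }
  exists (mkworld (S (lev q')) r Hr Hh). change (lev (mkworld _ r Hr Hh)) with (S (lev q')).
  change (thy (mkworld _ r Hr Hh)) with r. repeat split; try lia; auto.
  - intros C HC. apply derives_base; auto. apply (thyP p); auto.
  - destruct H as [Hs Hs']; auto.
Qed.

Definition cframe (L : list ty) (w : cworld L) : LAframe.
Proof.
  refine {| W := cworld L; W_inh := inhabits w;
    succ := fun p q => lev q < lev p /\ forall C, thy p (TLater C) -> thy q C;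
    Rel := fun p q => lev q <= lev p /\ forall C, thy p C -> thy q C;
    fr_ax3 := cframe_ax3 L |}.
  - intros [f Hf]. assert (H : forall n, lev (f n) + n <= lev (f 0)).
    { induction n as [|n IH]; [lia|]. destruct (Hf n) as [H _]. lia. }
    specialize (H (S (lev (f 0)))). lia.
  - auto.
  - intros p q r [? ?] [? ?]; split; [lia|auto].
  - intros p q r [? ?] [? ?]; split; [lia|auto].
  - intros p q [? H]; split; [lia|]. intros C HC. apply H, theory_later; auto using thyP.
Defined.

Definition cval (L : list ty) (w : cworld L) : valuation (cframe L w) :=
  fun X p => asbool (thy (p : cworld L) (TFVar X)).

Lemma hereditary_cval L w : hereditary (cframe L w) (cval L w).
Proof. intros X p q [_ H]; unfold cval; rewrite !asboolE; auto. Qed.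

(** Confined to [L] because the number of a world guarantees a refuting successor only for boxed
    formulas of [L]; decomposability keeps the induction inside [L]. *)
Lemma truth_lemma L w : (forall C, In C L -> wf C) ->
  (forall C, In C L -> decomposable L C) ->
  forall (p : cworld L) A, In A L ->
  (forces (cframe L w) (cval L w) p A <-> thy p A).
Proof.
  intros HL HD p A. remember ((p, A) : W (cframe L w) * ty) as x eqn:E. revert p A E.
  induction x as [x IH] using (well_founded_induction (fw_lt_wf (cframe L w))).
  intros p A -> HA. assert (HAw := HL A HA). assert (HAd := HD A HA).
  destruct (top_variant A) eqn:T.
  { split; intros; [|apply forces_top_variant; auto].
    apply (thyP p). exists []. split; [simpl; tauto|].
    apply LAmu_top_variant; simpl; tauto. }
  destruct A as [X|i|A B|A|A].
  - rewrite forces_var. unfold cval. apply asboolE.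
  - apply wf_wfb in HAw; simpl in HAw; lia.
  - destruct (wf_arr_inv _ _ HAw) as [HA1 HB1]. destruct (rk_arr _ _ T) as [R1 R2].
    destruct HAd as [HAL HBL].
    assert (K : forall q : cworld L, Rel (cframe L w) p q -> forall C, C = A \/ C = B ->
      (forces (cframe L w) (cval L w) q C <-> thy q C)).
    { intros q Hq C HC. eapply IH; [|reflexivity|].
      - right; simpl fst; simpl snd. split; auto. destruct HC; subst; auto.
      - destruct HC; subst; auto. }
    rewrite forces_arr. split.
    + intro H.
      assert (Hth : theory (derives (fun C => C = A \/ thy p C))).
      { apply derives_theory. intros C [->|HC]; auto. apply (thyP p); auto. }
      assert (Hsub : forall C, thy p C -> derives (fun C => C = A \/ thy p C) C).
      { intros C HC. apply derives_base; auto. apply (thyP p); auto. }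
      (* Adding [A] enlarges the theory, so the number of [p] still bounds the height. *)
      set (q := mkworld (lev p) _ Hth (height_mono L _ _ _ Hsub (levP p))).
      assert (Hpq : Rel (cframe L w) p q) by (split; [apply le_n|exact Hsub]).
      specialize (H q Hpq). rewrite !(K q Hpq) in H by auto.
      apply (thyP p), derives_intro; auto; [apply (thyP p)|]. apply H.
      apply derives_base; auto.
    + intros H q Hq. rewrite !(K q Hq) by auto. apply theory_mp; [apply thyP|].
      apply Hq; auto.
  - simpl in HAd. assert (HwA : wf A) by (apply wf_later_inv; auto).
    assert (K : forall q : cworld L, succ (cframe L w) p q ->
      (forces (cframe L w) (cval L w) q A <-> thy q A)).
    { intros q Hq. eapply IH; [|reflexivity|auto]. left; auto. }
    rewrite forces_later. split.
    + intro H. apply NNPP. intro Hn.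
      assert (Hh := levP p). destruct (lev p) as [|m] eqn:El.
      (* At level 0 no boxed formula of [L] is missing from the theory. *)
      { apply (Hh A); auto. }
      set (q := mkworld m _ (next_theory _ A (thyP p) HwA) (Hh A HA Hn)).
      assert (Hpq : succ (cframe L w) p q).
      { split.
        - change (m < lev p). lia.
        - intros C HC. apply next_sub; auto using thyP. }
      specialize (H q Hpq). rewrite (K q Hpq) in H.
      exact (next_refutes _ _ (thyP p) HwA Hn H).
    + intros H q Hq. rewrite (K q Hq). apply Hq; auto.
  - assert (HU := wf_unfold _ HAw). rewrite forces_mu by auto.
    rewrite (IH (p, open A (TMu A))) with (A := open A (TMu A)) (p := p); auto.
    + split; apply theory_rule; auto using thyP.
      * apply LA_fold; auto. apply LAmu_self; auto.
      * apply LA_unfold, LAmu_self; auto.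
    + right. split; [apply Rel_refl|]. apply rk_unfold; auto.
Qed.

Lemma completeness As B : (forall A, In A As -> wf A) -> wf B ->
  (forall (F : LAframe) (xi : valuation F), hereditary F xi ->
     forall p : W F, (forall A, In A As -> forces F xi p A) -> forces F xi p B) ->
  LAmu As B.
Proof.
  intros HAs HB Hv.
  set (L := flat_map (subforms []) (B :: As)).
  assert (Hin : forall C, In C (B :: As) -> In C L).
  { intros C HC. apply in_flat_map. exists C. split; auto.
    rewrite <- (inst_nil C) at 1; [apply subforms_head|]. destruct HC; subst; auto. }
  assert (Hd : forall C, In C L -> decomposable L C).
  { intros C HC. apply in_flat_map in HC. destruct HC as (D & HD & HC).
    apply (subforms_decomposable L D [] 0); simpl; try tauto.
    - apply wf_wfb. destruct HD; subst; auto.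
    - intros E HE. apply in_flat_map; eauto. }
  assert (HL : forall C, In C L -> wf C).
  { intros C HC. apply in_flat_map in HC. destruct HC as (D & HD & HC).
    apply (subforms_wf D [] 0); simpl; try tauto.
    apply wf_wfb. destruct HD; subst; auto. }
  assert (Hth : theory (derives (fun C => In C As))) by (apply derives_theory; auto).
  set (p := mkworld (length L) _ Hth (theory_height L HL _ Hth)).
  assert (Ht := truth_lemma L p HL Hd p).
  assert (HpB : thy p B).
  { apply Ht; [apply Hin; simpl; auto|]. apply Hv; [apply hereditary_cval|].
    intros A HA. apply Ht; [apply Hin; simpl; auto|]. apply derives_base; auto. }
  destruct HpB as (l & Hl & H). apply (LAmu_weaken l); auto.
Qed.

(** * Terms for LAmu derivations *)

Fixpoint lcn (k : nat) (M : tm) : Prop :=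
  match M with
  | tvar _ => True
  | tbvar i => i < k
  | tlam N => lcn (S k) N
  | tapp N P => lcn k N /\ lcn k P
  end.

Fixpoint tsize (M : tm) : nat :=
  match M with
  | tlam N => S (tsize N)
  | tapp N P => S (tsize N + tsize P)
  | _ => 0
  end.

Lemma tsize_open k x M : tsize (open_tm_rec k (tvar x) M) = tsize M.
Proof.
  revert k; induction M; intro k; simpl; auto. destruct (Nat.eqb n k); auto.
Qed.

Lemma lcn_open k x M : lcn k (open_tm_rec k (tvar x) M) <-> lcn (S k) M.
Proof.
  revert k; induction M; intro k; simpl; try tauto.
  - destruct (Nat.eqb_spec n k); simpl; lia.
  - apply IHM.
  - rewrite IHM1, IHM2; tauto.
Qed.

Lemma lc_tm_lcn M : lc_tm M <-> lcn 0 M.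
Proof.
  split.
  - induction 1; simpl; auto. apply (lcn_open 0 0), (H0 0).
  - remember (tsize M) as n eqn:E. assert (Hn : tsize M <= n) by lia. clear E.
    revert M Hn; induction n; intros M Hn H; destruct M; simpl in *; try lia.
    1, 2: constructor.
    + constructor. intro x. apply IHn; [unfold open_tm; rewrite tsize_open; lia|].
      apply lcn_open; auto.
    + constructor; apply IHn; tauto || lia.
Qed.

Fixpoint close_tm (k x : nat) (M : tm) : tm :=
  match M with
  | tvar y => if Nat.eqb y x then tbvar k else tvar y
  | tbvar i => tbvar i
  | tlam N => tlam (close_tm (S k) x N)
  | tapp N P => tapp (close_tm k x N) (close_tm k x P)
  end.

Lemma open_close_tm k x M : lcn k M ->
  open_tm_rec k (tvar x) (close_tm k x M) = M.
Proof.
  revert k; induction M; intros k H; simpl in *; auto.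
  - destruct (Nat.eqb_spec n x); simpl; auto. rewrite Nat.eqb_refl; congruence.
  - destruct (Nat.eqb_spec n k); auto; lia.
  - rewrite IHM; auto.
  - rewrite IHM1, IHM2; tauto.
Qed.

Lemma fv_close_tm k x M : ~ In x (fv_tm (close_tm k x M)).
Proof.
  revert k; induction M; intro k; simpl; auto.
  - destruct (Nat.eqb_spec n x); simpl; intuition.
  - rewrite in_app_iff. specialize (IHM1 k). specialize (IHM2 k). tauto.
Qed.

Lemma lcn_close_tm k x M : lcn k M -> lcn (S k) (close_tm k x M).
Proof.
  revert k; induction M; intros k H; simpl in *; auto.
  - destruct (Nat.eqb n x); simpl; auto; lia.
  - intuition.
Qed.

Fixpoint rename (r : nat -> nat) (M : tm) : tm :=
  match M with
  | tvar x => tvar (r x)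
  | tbvar i => tbvar i
  | tlam N => tlam (rename r N)
  | tapp N P => tapp (rename r N) (rename r P)
  end.

Lemma rename_id M : rename (fun x => x) M = M.
Proof. induction M; simpl; congruence. Qed.

Lemma rename_ext r r' M : (forall x, In x (fv_tm M) -> r x = r' x) ->
  rename r M = rename r' M.
Proof.
  induction M; simpl; intro H; f_equal; auto;
    (apply IHM1 || apply IHM2); intros; apply H, in_app_iff; auto.
Qed.

Lemma rename_open r k x M :
  rename r (open_tm_rec k (tvar x) M) = open_tm_rec k (tvar (r x)) (rename r M).
Proof.
  revert k; induction M; intro k; simpl; try congruence.
  destruct (Nat.eqb n k); auto.
Qed.

Lemma lcn_rename r k M : lcn k M -> lcn k (rename r M).
Proof. revert k; induction M; simpl; intuition. Qed.

Lemma ctx_fresh G l : ctx_ok G -> exists x, G x = None /\ ~ In x l.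
Proof.
  intros [[l' Hl] _]. destruct (exists_fresh (l' ++ l)) as [x Hx].
  rewrite in_app_iff in Hx. exists x. split; [|tauto].
  specialize (Hl x). destruct (G x); auto. exfalso; apply Hx; left; apply Hl; congruence.
Qed.

Lemma ctx_ok_extend G x A : ctx_ok G -> wf A -> ctx_ok (ctx_union G (ctx_single x A)).
Proof.
  intros [[l Hl] Hw] HA. unfold ctx_union, ctx_single. split.
  - exists (x :: l). intros y Hy. destruct (Nat.eqb_spec y x); simpl; auto.
    right; apply Hl. destruct (G y); congruence.
  - intros y C HC. destruct (G y) eqn:E.
    + inversion HC; subst; eauto.
    + destruct (Nat.eqb y x); inversion HC; subst; auto.
Qed.

Lemma ctx_ok_later G : ctx_ok G -> ctx_ok (ctx_later G).
Proof.
  intros [[l Hl] Hw]. unfold ctx_later. split.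
  - exists l. intros x Hx. apply Hl. destruct (G x); simpl in *; congruence.
  - intros x C HC. destruct (G x) eqn:E; simpl in HC; inversion HC; subst.
    apply wf_later; eauto.
Qed.

Lemma ctx_single_eq x A : ctx_single x A x = Some A.
Proof. unfold ctx_single; rewrite Nat.eqb_refl; auto. Qed.

(** Weakening needs renaming in its induction: the name chosen under a lambda may be declared in the
    larger context and is then replaced by a fresh one. *)
Lemma typing_rename G M A : typing G M A -> forall r G', ctx_ok G' ->
  (forall x C, G x = Some C -> G' (r x) = Some C) -> typing G' (rename r M) A.
Proof.
  induction 1 as [G x A HG HGx|G G1 M A HT IH Hl|G M HG HM|G M A B HT IH HS
    |G G1 M x A B Hx HT IH Hc Hu|G G1 G2 M N A B HT1 IH1 HT2 IH2 Hc Hu];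
    intros r G' HG' Hr.
  - apply T_var; auto.
  - apply (T_shift G' (ctx_later G')); auto. apply IH; [apply ctx_ok_later; auto|].
    intros x C HC. rewrite Hl in HC. unfold ctx_later in *.
    destruct (G x) eqn:E; simpl in HC; [|discriminate]. rewrite (Hr x t); auto.
  - apply T_top; auto. apply lc_tm_lcn, lcn_rename, lc_tm_lcn; auto.
  - eapply T_sub; eauto.
  - assert (HG1x : G1 x = Some A).
    { rewrite Hu. unfold ctx_union. destruct (G x) eqn:E; [|apply ctx_single_eq].
      f_equal. apply (Hc x); auto using ctx_single_eq. }
    assert (HA : wf A) by (apply typing_wf in HT; eapply (proj1 HT); eauto).
    destruct (ctx_fresh G' (fv_tm (rename r M)) HG') as (x' & Hx' & HxM).
    simpl. apply (T_abs G' (ctx_union G' (ctx_single x' A)) _ x'); auto.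
    + set (r' := fun y => if Nat.eqb y x then x' else r y).
      replace (open_tm (rename r M) (tvar x')) with (rename r' (open_tm M (tvar x))).
      * apply IH; [apply ctx_ok_extend; auto|]. intros y C HC. unfold r', ctx_union.
        destruct (Nat.eqb_spec y x) as [->|NE].
        -- rewrite Hx', ctx_single_eq; congruence.
        -- rewrite Hu in HC. unfold ctx_union, ctx_single in HC.
           destruct (G y) eqn:E; [|apply Nat.eqb_neq in NE; rewrite NE in HC; discriminate].
           rewrite (Hr y t); auto.
      * unfold open_tm. rewrite rename_open. unfold r' at 1. rewrite Nat.eqb_refl.
        f_equal. apply rename_ext. intros y Hy. unfold r'.
        destruct (Nat.eqb_spec y x); subst; tauto.
    + intros y C D HC HD. unfold ctx_single in HD. destruct (Nat.eqb_spec y x'); congruence.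
  - apply (T_app G' G' G' _ _ A).
    + apply IH1; auto. intros x C HC. apply Hr. rewrite Hu. unfold ctx_union.
      rewrite HC; auto.
    + apply IH2; auto. intros x C HC. apply Hr. rewrite Hu. unfold ctx_union.
      destruct (G1 x) eqn:E; auto. f_equal. eapply Hc; eauto.
    + intros x C D; congruence.
    + intro x; unfold ctx_union; destruct (G' x); auto.
Qed.

Lemma typing_weaken G G' M A : typing G M A -> ctx_ok G' ->
  (forall x C, G x = Some C -> G' x = Some C) -> typing G' M A.
Proof. intros H HG' Hi. rewrite <- (rename_id M). eapply typing_rename; eauto. Qed.

Lemma assump_ok_nil : assump_ok [].
Proof. intros p q []. Qed.

Lemma typing_eq G M A B : typing G M A -> simeq A B -> typing G M B.
Proof. intros H E. apply (T_sub _ _ A); auto. apply sub_eq; auto using assump_ok_nil. Qed.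

Lemma typing_approx G M A : typing G M A -> typing G M (TLater A).
Proof.
  intros H. apply (T_sub _ _ A); auto. apply typing_wf in H.
  apply sub_approx; [apply assump_ok_nil|tauto].
Qed.

Lemma typing_nec G M A : typing G M A -> typing (ctx_later G) M (TLater A).
Proof.
  induction 1 as [G x A HG HGx|G G1 M A HT IH Hl|G M HG HM|G M A B HT IH HS
    |G G1 M x A B Hx HT IH Hc Hu|G G1 G2 M N A B HT1 IH1 HT2 IH2 Hc Hu].
  - apply T_var; [apply ctx_ok_later; auto|]. unfold ctx_later; rewrite HGx; auto.
  - apply (T_shift _ (ctx_later G1)); auto. intro x. unfold ctx_later at 1.
    rewrite Hl; auto.
  - apply typing_approx, T_top; auto using ctx_ok_later.
  - apply (T_sub _ _ (TLater A)); auto. apply sub_later; auto.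
  - assert (HT' := typing_wf _ _ _ (T_abs _ _ _ _ _ _ Hx HT Hc Hu)).
    destruct HT' as [_ HAB]. apply wf_arr_inv in HAB.
    apply (typing_eq _ _ (TArr (TLater A) (TLater B)));
      [|apply teq_sym, teq_distr; tauto].
    apply (T_abs _ (ctx_later G1) _ x); auto.
    + intros y C D HC HD. unfold ctx_later, ctx_single in *.
      destruct (G y) eqn:E; simpl in HC; inversion HC; subst.
      destruct (Nat.eqb_spec y x); inversion HD; subst. f_equal.
      apply (Hc x); auto. rewrite Nat.eqb_refl; auto.
    + intro y. unfold ctx_later at 1. rewrite Hu. unfold ctx_later, ctx_union, ctx_single.
      destruct (G y); auto. destruct (Nat.eqb y x); auto.
  - assert (HT' := typing_wf _ _ _ HT1). destruct HT' as [_ HAB].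
    apply wf_arr_inv in HAB.
    apply (T_app _ (ctx_later G1) (ctx_later G2) _ _ (TLater A)); auto.
    + apply (typing_eq _ _ (TLater (TArr A B))); auto. apply teq_distr; tauto.
    + intros x C D HC HD. unfold ctx_later in *.
      destruct (G1 x) eqn:E1, (G2 x) eqn:E2; simpl in *; try discriminate.
      rewrite (Hc x t t0) in HC; congruence.
    + intro x. unfold ctx_later at 1. rewrite Hu. unfold ctx_later, ctx_union.
      destruct (G1 x); auto.
Qed.

(** Asking only that [G] declare some variable for each formula of [D] lets both premises of an
    application share one context, so sets of formulae never have to be matched with splittings of
    contexts. *)
Lemma LAmu_typing D A : LAmu D A -> forall G, ctx_ok G ->
  (forall C, In C D -> exists x, G x = Some C) -> exists M, lc_tm M /\ typing G M A.
Proof.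
  induction 1 as [D A HD HA|D D1 D2 A HT IH H2 HD|D A _ IH
    |D D' A B HT IH HD|D D1 D2 A B _ IH1 _ IH2 HD
    |D A HA _ IH|D A HT IH|D A B HT IH|D A _ IH]; intros G HG HC.
  - destruct (HC A HA) as [x Hx]. exists (tvar x). split; constructor; auto.
  (* Necessitation is applied to the boxed declarations of [G] with one bullet removed; boxing them
     again gives a part of [G]. *)
  - set (G1 := fun x => match G x with Some (TLater C) => Some C | _ => None end).
    assert (HG1 : forall x C, G1 x = Some C -> G x = Some (TLater C)).
    { intros x C HC1. unfold G1 in HC1.
      destruct (G x) as [[]|]; congruence. }
    assert (HG1' : ctx_ok G1).
    { destruct HG as [[l Hl] Hw]. split.
      - exists l. intros x Hx. apply Hl. destruct (G1 x) eqn:E; [|congruence].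
        rewrite (HG1 x t); congruence.
      - intros x C HC1. apply wf_later_inv. eauto. }
    destruct (IH G1 HG1') as (M & HM & HMt).
    + intros C HC1. destruct (HC (TLater C)) as [x Hx].
      { apply HD, in_app_iff. left; apply in_map; auto. }
      exists x. unfold G1. rewrite Hx; auto.
    + exists M. split; auto. apply (typing_weaken (ctx_later G1)); auto using typing_nec.
      intros x C HC1. unfold ctx_later in HC1.
      destruct (G1 x) eqn:E; inversion HC1; subst; auto.
  - destruct (IH G HG HC) as (M & HM & HMt). exists M. auto using typing_approx.
  - destruct (ctx_fresh G [] HG) as (x & Hx & _).
    assert (HA : wf A) by (apply (proj1 (LAmu_wf _ _ HT)), HD; simpl; auto).
    destruct (IH (ctx_union G (ctx_single x A))) as (M & HM & HMt).
    + apply ctx_ok_extend; auto.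
    + intros C HC1. apply HD in HC1. unfold ctx_union. destruct HC1 as [<-|HC1].
      * exists x. rewrite Hx. apply ctx_single_eq.
      * destruct (HC C HC1) as [y Hy]. exists y. rewrite Hy; auto.
    + apply lc_tm_lcn in HM. exists (tlam (close_tm 0 x M)). split.
      * apply lc_tm_lcn. apply lcn_close_tm; auto.
      * apply (T_abs G (ctx_union G (ctx_single x A)) _ x); auto using fv_close_tm.
        -- unfold open_tm. rewrite open_close_tm; auto.
        -- intros y C E HC1 HE. unfold ctx_single in HE.
           destruct (Nat.eqb_spec y x); congruence.
  - destruct (IH1 G HG) as (M & HM & HMt).
    { intros; apply HC, HD, in_app_iff; auto. }
    destruct (IH2 G HG) as (N & HN & HNt).
    { intros; apply HC, HD, in_app_iff; auto. }
    exists (tapp M N). split; [constructor; auto|].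
    apply (T_app G G G _ _ A); auto.
    + intros x C E; congruence.
    + intro x; unfold ctx_union; destruct (G x); auto.
  - destruct (IH G HG HC) as (M & HM & HMt). exists M. split; auto.
    apply (typing_eq _ _ _ _ HMt). apply teq_sym, teq_unfold; auto.
  - destruct (IH G HG HC) as (M & HM & HMt). exists M. split; auto.
    apply (typing_eq _ _ _ _ HMt). apply teq_unfold. apply LAmu_wf in HT; tauto.
  - destruct (IH G HG HC) as (M & HM & HMt). exists M. split; auto.
    apply (typing_eq _ _ _ _ HMt). apply LAmu_wf in HT. destruct HT as [_ HAB].
    apply wf_arr_inv in HAB. apply teq_sym, teq_distr; auto; apply wf_later_inv; tauto.
  - destruct (IH G HG HC) as (M & HM & HMt). exists M. auto using typing_approx.
Qed.

Lemma ctx_of_in xs As x A : ctx_of xs As x = Some A -> In x xs /\ In A As.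
Proof.
  revert As; induction xs as [|y xs IH]; intros [|B As]; simpl; try discriminate.
  destruct (Nat.eqb_spec x y); intro H.
  - inversion H; subst; auto.
  - apply IH in H. tauto.
Qed.

Lemma ctx_of_ok xs As : (forall A, In A As -> wf A) -> ctx_ok (ctx_of xs As).
Proof.
  intro H. split.
  - exists xs. intros x Hx. destruct (ctx_of xs As x) eqn:E; [|congruence].
    apply ctx_of_in in E; tauto.
  - intros x A E. apply ctx_of_in in E. apply H; tauto.
Qed.

Lemma ctx_of_covers xs As : length xs = length As -> NoDup xs ->
  forall A, In A As -> exists x, ctx_of xs As x = Some A.
Proof.
  revert As; induction xs as [|y xs IH]; intros [|B As] El Hn A HA;
    try discriminate; [destruct HA|].
  inversion Hn as [|? ? Hy Hn']; subst. destruct HA as [<-|HA].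
  - exists y. simpl. rewrite Nat.eqb_refl; auto.
  - simpl in El. destruct (IH As) with (A := A) as [x Hx]; auto.
    exists x. simpl. apply ctx_of_in in Hx as Hx'.
    destruct (Nat.eqb_spec x y); auto. subst; tauto.
Qed.

Theorem theorem10 (As : list ty) (B : ty)
  (HAs : forall A, In A As -> wf A) (HB : wf B) :
  (* (a) <-> (b) *)
  (LAmu As B <->
     exists (xs : list nat) (M : tm),
       length xs = length As /\ NoDup xs /\ lc_tm M /\
       typing (ctx_of xs As) M B)
  /\
  (* (a) <-> (c) *)
  (LAmu As B <->
     forall (F : LAframe) (xi : valuation F), hereditary F xi ->
       forall p : W F, (forall A, In A As -> forces F xi p A) ->
         forces F xi p B).
Proof.
  assert (Hab : LAmu As B -> exists (xs : list nat) (M : tm),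
    length xs = length As /\ NoDup xs /\ lc_tm M /\ typing (ctx_of xs As) M B).
  { intro H. assert (El := length_seq (length As) 0).
    assert (Hn := seq_NoDup (length As) 0).
    destruct (LAmu_typing _ _ H (ctx_of (seq 0 (length As)) As)) as (M & HM & HMt).
    - apply ctx_of_ok; auto.
    - apply ctx_of_covers; auto.
    - exists (seq 0 (length As)), M; auto. }
  assert (Hbc : (exists (xs : list nat) (M : tm),
    length xs = length As /\ NoDup xs /\ lc_tm M /\ typing (ctx_of xs As) M B) ->
    forall (F : LAframe) (xi : valuation F), hereditary F xi ->
       forall p : W F, (forall A, In A As -> forces F xi p A) -> forces F xi p B).
  { intros (xs & M & _ & _ & _ & HT) F xi Hx p Hp.
    apply (typing_sound _ _ _ HT); auto. intros x C HC. apply ctx_of_in in HC.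
    apply Hp; tauto. }
  assert (Hca := completeness As B HAs HB).
  tauto.
Qed.
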